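(* Let $\nu\in\mathbb R$ with $|\nu|\neq1$, let $s,s',b,b'\in\mathbb R$, and let $c,c'>\frac12$. Consider the bilinear estimates $$\text{(E1)}\quad \|\partial_x(u_1\overline{u_2})\|_{Y^{s',c'-1}}\le C\,\|u_1\|_{X^{s,b}}\|u_2\|_{X^{s,b}},\qquad\qquad \text{(E2)}\quad \|uv\|_{X^{s,c-1}}\le C\,\|u\|_{X^{s,b}}\|v\|_{Y^{s',b'}}.$$ (i) If $s+\frac12\le s'$, then (E1) fails, i.e. there is no constant $C>0$ for which (E1) holds for all $u_1,u_2$. (ii) If $s'\le s-\frac32$, then (E2) fails, i.e. there is no constant $C>0$ for which (E2) holds for all $u,v$. (iii) If $\nu=0$ and $s'\le s-1$, then (E2) fails, i.e. there is no constant $C>0$ for which (E2) holds for all $u,v$.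
   Context: Write $\langle\cdot\rangle=\sqrt{1+|\cdot|^2}$ and let $\widehat f(\tau,\xi)=\iint e^{-2\pi i(t\tau+x\xi)}f(t,x)\,dt\,dx$ be the space-time Fourier transform of complex-valued functions on $\mathbb R^2$ (variables $(t,x)$). For $s,a,s',a'\in\mathbb R$, the Bourgain spaces $X^{s,a}$ and $Y^{s',a'}=Y^{s',a'}_\nu$ are the completions of the Schwartz class $\mathcal S(\mathbb R^2)$ under the norms $$\|f\|_{X^{s,a}}=\|\langle\xi\rangle^s\langle\tau+\xi^2\rangle^a\widehat f(\tau,\xi)\|_{L^2_{\tau,\xi}},\qquad \|g\|_{Y^{s',a'}}=\|\langle\xi\rangle^{s'}\langle\tau+\nu|\xi|\xi\rangle^{a'}\widehat g(\tau,\xi)\|_{L^2_{\tau,\xi}} .$$ Here $u_1,u_2,u,v$ range over the Schwartz class $\mathcal S(\mathbb R^2)$ (dense in the spaces concerned). *)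

(* Defs.v *)
From HB Require Import structures.
From mathcomp Require Import all_boot all_order all_algebra.
From mathcomp Require Import all_classical all_reals all_analysis.
From mathcomp Require Import complex.

Set Implicit Arguments.
Unset Strict Implicit.
Unset Printing Implicit Defensive.

Import Order.TTheory GRing.Theory Num.Theory.
Import numFieldNormedType.Exports.
Local Open Scope ring_scope.
Local Open Scope complex_scope.

(* Points of the plane are pairs: (t, x) in physical space, (tau, xi) in
   frequency space.  R[i] has no normed R-module instance, so differentiation
   and integration of complex-valued functions are done on real and imaginary
   parts. *)

Definition re_part (R : realType) (f : R * R -> R[i]) : R * R -> R :=
  fun p => complex.Re (f p).

Definition im_part (R : realType) (f : R * R -> R[i]) : R * R -> R :=
  fun p => complex.Im (f p).

Definition dt (R : realType) (g : R * R -> R) : R * R -> R :=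
  fun p => 'D_(1, 0) g p.

Definition dx (R : realType) (g : R * R -> R) : R * R -> R :=
  fun p => 'D_(0, 1) g p.

(* Differentiability is Frechet differentiability; required of all the
   derivatives dt^j dx^k g, it forces them all to be continuous, hence g to be
   infinitely differentiable with mixed derivatives independent of the order. *)
Definition schwartz_real (R : realType) (g : R * R -> R) : Prop :=
  forall j k : nat,
    (forall p : R * R, differentiable (iter j (@dt R) (iter k (@dx R) g)) p) /\
    (forall m n : nat, exists M : R, forall p : R * R,
       `|p.1 ^+ m * p.2 ^+ n * iter j (@dt R) (iter k (@dx R) g) p| <= M).

Definition schwartz (R : realType) (f : R * R -> R[i]) : Prop :=
  schwartz_real (re_part f) /\ schwartz_real (im_part f).

Definition dxC (R : realType) (f : R * R -> R[i]) : R * R -> R[i] :=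
  fun p => dx (re_part f) p +i* dx (im_part f) p.

Notation lebesgue2 R := (@lebesgue_measure R \x @lebesgue_measure R)%E.

Definition expi (R : realType) (y : R) : R[i] := cos y +i* sin y.

Definition fourier (R : realType) (f : R * R -> R[i]) : R * R -> R[i] :=
  fun q =>
    let h : R * R -> R[i] :=
      fun p => expi (- (2 * pi * (p.1 * q.1 + p.2 * q.2))) * f p in
    (\int[lebesgue2 R]_p re_part h p) +i* (\int[lebesgue2 R]_p im_part h p).

(* The Japanese bracket <y>. *)
Definition jap (R : realType) (y : R) : R := Num.sqrt (1 + `|y| ^+ 2).

Definition normX (R : realType) (s a : R) (f : R * R -> R[i]) : \bar R :=
  Lnorm (lebesgue2 R)%E 2%:E (fun q =>
     (jap q.2 `^ s * jap (q.1 + q.2 ^+ 2) `^ a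
      * Normc.normc (fourier f q))%:E).

Definition normY (R : realType) (nu s a : R) (g : R * R -> R[i]) : \bar R :=
  Lnorm (lebesgue2 R)%E 2%:E (fun q =>
     (jap q.2 `^ s * jap (q.1 + nu * `|q.2| * q.2) `^ a
      * Normc.normc (fourier g q))%:E).

Definition E1 (R : realType) (nu s s' b c' C : R) : Prop :=
  forall u1 u2 : R * R -> R[i], schwartz u1 -> schwartz u2 ->
    (normY nu s' (c' - 1) (dxC (fun p => (u1 p * (u2 p)^*)%R))
     <= C%:E * normX s b u1 * normX s b u2)%E.

Definition E2 (R : realType) (nu s s' b b' c C : R) : Prop :=
  forall u v : R * R -> R[i], schwartz u -> schwartz v ->
    (normX s (c - 1) (fun p => (u p * v p)%R)
     <= C%:E * normX s b u * normY nu s' b' v)%E.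

(* Main.v *)
(* Each estimate is tested on two Gaussian wave packets, one at frequency 0 and
   one at frequency N on its own curve, both of width 1 in tau and 1/L in xi.
   With L = N (or L = 1 for nu = 0) the packets stay within O(1) of their curves,
   so b and b' only contribute constants and the norms are about <N>^s L^{1/2},
   s being the spatial exponent of the space.  The product is a packet of the
   same shape at frequency N, and since |nu| <> 1 it sits at distance about N^2
   from the output curve, so its norm is about N^{s + 2(c-1)} L^{1/2}, with one
   more factor N from the derivative in (E1).  Comparing powers of N, the loss
   2(c-1) > -1 contradicts the estimates as N tends to infinity. *)
From HB Require Import structures.
From mathcomp Require Import all_boot all_order all_algebra.
From mathcomp Require Import all_classical all_reals all_analysis.
From mathcomp Require Import measurable_realfun complex.
From mathcomp Require Import ring lra.
Require Import Defs.

Set Implicit Arguments.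
Unset Strict Implicit.
Unset Printing Implicit Defensive.

Import Order.TTheory GRing.Theory Num.Theory.
Import numFieldNormedType.Exports.
Local Open Scope classical_set_scope.
Local Open Scope ring_scope.

(** * One-dimensional Gaussian integrals *)

(** Gaussians are chosen because they are closed under products and under the Fourier transform: the
    transform of the product packet is again an explicit nonnegative Gaussian, so no convolution has
    to be estimated, and its norm is bounded below by the contribution of a single box. The price is
    that the packets have tails: the polynomial weights must be controlled at every distance from
    the centre, uniformly in N and L, and half of the Gaussian is spent on this. The width 1/L comes
    from the slope of the curves, which is of order N at frequency N: over an interval of length 1/N
    they move by O(1). For nu = 0 the curve of Y is the line tau = 0, so no narrowing is required in
    (E2), where only the packet of v sits at frequency N. The right-hand sides carry L^{1/2} twice,
    the left-hand sides once. Cancelling leaves N^{1 + s' + 2(c'-1)} against N^{s + 1/2} for (E1),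
    and N^{s + 2(c-1)} against N^{s'} L^{1/2} for (E2). *)

Section GaussianIntegrals.
Context {R : realType}.
Implicit Types (B x th : R).
Notation mu := (@lebesgue_measure R).

(** The factor pi makes the family stable under the transform with kernel e^{-2 pi i x xi}:
    [gauss B] is sent to B^{-1/2} [gauss B^-1]. *)
Definition gauss B x : R := expR (- (pi * B * x ^+ 2)).

Lemma gauss_ge0 B x : 0 <= gauss B x. Proof. exact: expR_ge0. Qed.

Lemma gaussM A B x : gauss A x * gauss B x = gauss (A + B) x.
Proof. by rewrite /gauss -expRD; congr expR; ring. Qed.

Lemma continuous_gauss B : continuous (gauss B).
Proof.
move=> x; apply: (@continuous_comp _ _ _ (fun x => - (pi * B * x ^+ 2)) expR);
  last exact: continuous_expR.
apply: continuousN; apply: (@continuousM _ R); first exact: cst_continuous.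
exact: exprn_continuous.
Qed.

Lemma measurable_gauss B : measurable_fun setT (gauss B).
Proof. exact: (continuous_measurable_fun (@continuous_gauss B)). Qed.

(** Recognising a normal density of standard deviation (2 pi B)^{-1/2} imports integrability and the
    total mass from probability theory. *)
Lemma gauss_normal_pdf B m x : 0 < B ->
  gauss B (x - m) = (Num.sqrt B)^-1 * normal_pdf m (Num.sqrt (2 * pi * B))^-1 x.
Proof.
move=> B0; have p0 := pi_gt0 R.
have p2B : 0 < 2 * pi * B by rewrite !mulr_gt0.
rewrite normal_pdfE ?invr_neq0 ?gt_eqF ?sqrtr_gt0//.
rewrite /normal_peak /normal_fun exprVn sqr_sqrtr ?ltW//.
have -> : (2 * pi * B)^-1 * pi *+ 2 = B^-1.
  rewrite -mulr_natr; move: (pi : R) p0 => p p0; field.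
  by rewrite !gt_eqF.
rewrite sqrtrV ?ltW// invrK mulKf ?gt_eqF ?sqrtr_gt0//.
rewrite /gauss; congr expR; rewrite -mulr_natr.
by move: (pi : R) p0 => p p0; field; rewrite !gt_eqF.
Qed.

Lemma integrable_gauss_center B m : 0 < B ->
  mu.-integrable setT (fun x => (gauss B (x - m))%:E).
Proof.
move=> B0; under eq_fun do rewrite gauss_normal_pdf// EFinM.
by apply: integrableZl => //; exact: integrable_normal_pdf.
Qed.

Lemma integral_gauss_center B m : 0 < B ->
  (\int[mu]_x (gauss B (x - m))%:E)%E = ((Num.sqrt B)^-1)%:E.
Proof.
move=> B0; under eq_integral do rewrite gauss_normal_pdf// EFinM.
rewrite integralZl//=; last exact: integrable_normal_pdf.
by rewrite integral_normal_pdf mule1.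
Qed.

Lemma integrable_gauss B : 0 < B -> mu.-integrable setT (EFin \o gauss B).
Proof.
move=> B0; rewrite (_ : _ \o _ = fun x => (gauss B (x - 0))%:E).
  exact: integrable_gauss_center.
by apply/funext => x /=; rewrite subr0.
Qed.

Lemma Rintegral_gauss B : 0 < B ->
  (\int[mu]_x gauss B x)%R = (Num.sqrt B)^-1.
Proof.
move=> B0; rewrite /Rintegral -[RHS]/(fine ((Num.sqrt B)^-1)%:E).
rewrite -(integral_gauss_center 0 B0).
by congr fine; apply: eq_integral => x _; rewrite subr0.
Qed.

Lemma le_gauss_integrable B K (f : R -> R) : 0 < B -> measurable_fun setT f ->
  (forall x, `|f x| <= K * gauss B x) -> mu.-integrable setT (EFin \o f).
Proof.
move=> B0 mf fK; apply: (@le_integrable _ _ _ mu _ measurableT _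
  (fun x => K%:E * (gauss B x)%:E)%E).
- exact/measurable_EFinP.
- move=> x _ /=; rewrite lee_fin (le_trans (fK x))//.
  by rewrite normrM (ger0_norm (gauss_ge0 _ _)) ler_wpM2r ?gauss_ge0// ler_norm.
- by apply: integrableZl => //; exact: integrable_gauss.
Qed.

(** Half of the exponent pays for |x|: exp(y) >= 1 + y with y = pi (B/2) x^2, and the prefactor
    makes the product dominate 1 + x^2 >= |x|. *)
Lemma id_gauss_le B x : 0 < B ->
  `|x| * gauss B x <= (1 + 2 / (pi * B)) * gauss (B / 2) x.
Proof.
move=> B0; have pB : 0 < pi * B by rewrite mulr_gt0 ?pi_gt0.
have -> : gauss B x = gauss (B / 2) x * gauss (B / 2) x.
  by rewrite /gauss -expRD; congr expR; move: (pi : R) => c; field.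
rewrite mulrA ler_wpM2r ?gauss_ge0//.
rewrite {1}/gauss expRN ler_pdivrMr ?expR_gt0//.
have y0 : 0 <= pi * (B / 2) * x ^+ 2.
  by rewrite mulr_ge0 ?sqr_ge0// mulrA mulr_ge0 ?ltW// invr_ge0.
apply: (@le_trans _ _ ((1 + 2 / (pi * B)) * (1 + pi * (B / 2) * x ^+ 2))); last first.
  rewrite ler_wpM2l ?expR_ge1Dx// addr_ge0// divr_ge0// ltW//.
have -> : (1 + 2 / (pi * B)) * (1 + pi * (B / 2) * x ^+ 2) =
    1 + x ^+ 2 + (2 / (pi * B) + pi * (B / 2) * x ^+ 2).
  by move: (pi : R) (pi_gt0 R) => p p0; field; rewrite !gt_eqF.
apply: (@le_trans _ _ (1 + x ^+ 2)).
  by rewrite -real_normK ?num_real//; have := sqr_ge0 (`|x| - 1); nra.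
by rewrite lerDl addr_ge0// divr_ge0// ltW.
Qed.

Lemma is_derive_gauss B x :
  is_derive x 1 (gauss B) (- (2 * pi * B * x) * gauss B x).
Proof.
have d : is_derive x 1 (- (pi * B) *: (@id R ^+ 2)) (- (2 * pi * B * x)).
  apply: is_derive_eq; rewrite /= expr1 /GRing.scale /=; ring.
rewrite mulrC (_ : gauss B = expR \o (- (pi * B) *: (@id R ^+ 2))); last first.
  by apply/funext => y; rewrite /gauss /= -mulNr.
exact: is_derive1_comp.
Qed.

End GaussianIntegrals.

(** * Fourier transform of a one-dimensional Gaussian *)

Section GaussianFourier1.
Context {R : realType}.
Implicit Types (B x th : R).
Notation mu := (@lebesgue_measure R).

Let measurable_id_gauss B : measurable_fun setT (fun x : R => x * gauss B x).
Proof. by apply: measurable_funM => //; exact: measurable_gauss. Qed.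

Lemma measurable_cosM th : measurable_fun setT (fun x : R => cos (th * x)).
Proof.
apply: measurableT_comp; last by apply: measurable_funM.
by apply: continuous_measurable_fun; exact: continuous_cos.
Qed.

Lemma measurable_sinM th : measurable_fun setT (fun x : R => sin (th * x)).
Proof.
apply: measurableT_comp; last by apply: measurable_funM.
by apply: continuous_measurable_fun; exact: continuous_sin.
Qed.

Lemma abs_cos_le1 (y : R) : `|cos y| <= 1.
Proof. by rewrite ler_norml cos_geN1 cos_le1. Qed.

Lemma abs_sin_le1 (y : R) : `|sin y| <= 1.
Proof. by rewrite ler_norml sin_geN1 sin_le1. Qed.

Lemma integrable_gauss_mul B (f : R -> R) : 0 < B -> measurable_fun setT f ->
  (forall x, `|f x| <= 1) ->
  mu.-integrable setT (EFin \o (fun x => gauss B x * f x)).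
Proof.
move=> B0 mf f1; apply: (@le_gauss_integrable _ B 1) => //.
  by apply: measurable_funM => //; exact: measurable_gauss.
move=> x; rewrite normrM (ger0_norm (gauss_ge0 _ _)) mulrC.
by rewrite ler_wpM2r ?gauss_ge0.
Qed.

Lemma integrable_id_gauss_mul B (f : R -> R) : 0 < B -> measurable_fun setT f ->
  (forall x, `|f x| <= 1) ->
  mu.-integrable setT (EFin \o (fun x => x * gauss B x * f x)).
Proof.
move=> B0 mf f1.
apply: (@le_gauss_integrable _ (B / 2) (1 + 2 / (pi * B))) => //.
- by rewrite divr_gt0.
- by apply: measurable_funM => //; exact: measurable_id_gauss.
- move=> x; rewrite normrM normrM (ger0_norm (gauss_ge0 _ _)).
  apply: le_trans (id_gauss_le _ B0).
  by rewrite ler_piMr// mulr_ge0 ?gauss_ge0.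
Qed.

Lemma gauss_cvg0 B (f : R -> R) : 0 < B -> (forall x, `|f x| <= 1) ->
  (gauss B (n%:R) * f (n%:R) @[n --> \oo] --> 0) /\
  (gauss B (- n%:R) * f (- n%:R) @[n --> \oo] --> 0).
Proof.
move=> B0 f1.
have bnd (e : R) : 0 < e ->
    \forall n \near \oo, gauss B (n%:R : R) < e.
  move=> e0; have pB : 0 < pi * B by rewrite mulr_gt0 ?pi_gt0.
  near=> n.
  have n1 : 1 <= n%:R :> R by rewrite ler1n; near: n; exact: nbhs_infty_gt.
  have nM : (pi * B * e)^-1 < n%:R.
    by near: n; exact: nbhs_infty_gtr.
  rewrite /gauss expRN invf_plt ?posrE ?expR_gt0//.
  apply: lt_le_trans (expR_ge1Dx _).
  have : e^-1 < pi * B * n%:R.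
    by rewrite -ltr_pdivrMl// -invfM.
  move=> /lt_le_trans; apply.
  apply: ler_wpDl => //; apply: ler_wpM2l; first exact: ltW.
  by rewrite expr2 ler_peMr// (le_trans _ n1).
split; apply/cvgrPdist_lt => e e0; near=> n; rewrite sub0r normrN normrM.
- rewrite (ger0_norm (gauss_ge0 _ _)) (le_lt_trans (ler_piMr _ (f1 _))) ?gauss_ge0//.
  by near: n; exact: bnd.
- rewrite (ger0_norm (gauss_ge0 _ _)) (le_lt_trans (ler_piMr _ (f1 _))) ?gauss_ge0//.
  by rewrite /gauss sqrrN; near: n; exact: bnd.
Unshelve. all: end_near. Qed.

(** Integration by parts on the whole line: the fundamental theorem of calculus on growing
    intervals, then dominated convergence with majorant |f|. Limits along the integers are
    enough. *)
Lemma Rintegral_derive_eq0 (f F : R -> R) : continuous f ->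
  (forall x, is_derive x 1 F (f x)) -> mu.-integrable setT (EFin \o f) ->
  F n%:R @[n --> \oo] --> 0 -> F (- n%:R) @[n --> \oo] --> 0 ->
  (\int[mu]_x f x)%R = 0.
Proof.
move=> cf dF intf F1 F2.
have mf : measurable_fun setT f by exact: continuous_measurable_fun.
(* The successor keeps the interval nondegenerate for n = 0, as the fundamental theorem of calculus
   requires; the shift is undone by [cvg_shiftS]. *)
pose I (n : nat) : set R := `[- n.+1%:R, n.+1%:R]%classic.
pose g n := (EFin \o f) \_ (I n).
have := @dominated_convergence _ _ _ mu _ measurableT g (EFin \o f)
  (fun x => `|(f x)%:E|)%E.
case.
- move=> n; rewrite /g; apply: (measurable_restrictT (EFin \o f) _).1 => //.
    exact: measurable_itv.
  by apply: measurable_funTS; exact/measurable_EFinP.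
- exact/measurable_EFinP.
- apply: aeW => x _; apply: cvg_near_cst; near=> n.
  rewrite /g patchE ifT// inE /I /= in_itv /= -ler_norml.
  apply: (@le_trans _ _ n%:R); last by rewrite ler_nat.
  by near: n; exact: nbhs_infty_ger.
- exact: integrable_abse.
- apply: aeW => x n _; rewrite /g patchE; case: ifP => // _.
  by rewrite abse0.
move=> _ _ h.
have FE : (fun n => \int[mu]_x g n x)%E = 
    (fun n => (F n.+1%:R - F (- n.+1%:R))%:E).
  apply/funext => n; rewrite /g -integral_mkcond.
  have cF : continuous F.
    by move=> x; apply/differentiable_continuous/derivable1_diffP; case: (dF x).
  rewrite (@continuous_FTC2 _ f F) ?EFinB//.
  - by rewrite gtrN ?ltr0n.
  - exact: continuous_subspaceT.
  - split; first by move=> x _; case: (dF x).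
    + exact/cvg_at_right_filter/cF.
    + exact/cvg_at_left_filter/cF.
  - by move=> x _; rewrite derive1E; case: (dF x).
rewrite FE in h.
have : (F n.+1%:R - F (- n.+1%:R))%:E @[n --> \oo] --> (0 - 0 : R)%:E.
  apply: cvg_EFin; first exact: nearW.
  by apply: cvgB; [move: F1|move: F2]; rewrite -cvg_shiftS.
rewrite subr0 => h0.
by rewrite /Rintegral; have -> := cvg_unique _ h h0.
Unshelve. all: end_near. Qed.

Lemma is_derive_cosM th x : is_derive x 1 (fun x => cos (th * x)) (- (th * sin (th * x))).
Proof.
rewrite (_ : (fun _ => _) = cos \o (th *: @id R))//.
apply: is_derive_eq; rewrite /GRing.scale /= mulr1; ring.
Qed.

Lemma is_derive_sinM th x : is_derive x 1 (fun x => sin (th * x)) (th * cos (th * x)).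
Proof.
rewrite (_ : (fun _ => _) = sin \o (th *: @id R))//.
apply: is_derive_eq; rewrite /GRing.scale /= mulr1; ring.
Qed.

Let is_derive_cont (f : R -> R) (df : R -> R) :
  (forall x : R, is_derive x 1 f (df x)) -> continuous f.
Proof.
by move=> d x; apply/differentiable_continuous/derivable1_diffP; case: (d x).
Qed.

Let continuous_cosM th : continuous (fun x : R => cos (th * x)).
Proof. exact: is_derive_cont (is_derive_cosM th). Qed.

Let continuous_sinM th : continuous (fun x : R => sin (th * x)).
Proof. exact: is_derive_cont (is_derive_sinM th). Qed.

Definition gauss_cos B th : R := (\int[mu]_x (gauss B x * cos (th * x)))%R.

Definition gauss_sin B th : R := (\int[mu]_x (gauss B x * sin (th * x)))%R.

(* Both identities below are [\int F' = 0] for F = gauss * sin, gauss * cos. *)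
Lemma Rintegral_id_gauss_sin B th : 0 < B ->
  (\int[mu]_x (x * gauss B x * sin (th * x)))%R = th / (2 * pi * B) * gauss_cos B th.
Proof.
move=> B0.
have i1 := integrable_id_gauss_mul B0 (measurable_sinM th) (fun x => abs_sin_le1 _).
have i2 := integrable_gauss_mul B0 (measurable_cosM th) (fun x => abs_cos_le1 _).
have i1' : mu.-integrable setT (EFin \o (fun x => - (2 * pi * B) * (x * gauss B x * sin (th * x)))).
  exact: (integrableZl measurableT _ i1).
have i2' : mu.-integrable setT (EFin \o (fun x => th * (gauss B x * cos (th * x)))).
  exact: (integrableZl measurableT _ i2).
have [l1 l2] := gauss_cvg0 B0 (fun x => abs_sin_le1 (th * x)).
have := @Rintegral_derive_eq0
  (fun x => - (2 * pi * B) * (x * gauss B x * sin (th * x)) + th * (gauss B x * cos (th * x)))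
  (fun x => gauss B x * sin (th * x)) _ _ _ l1 l2.
rewrite RintegralD//= RintegralZl//= RintegralZl//= -/(gauss_cos B th) => h.
apply: (@mulfI _ (2 * pi * B)); first by rewrite !mulf_neq0 ?gt_eqF ?pi_gt0.
rewrite mulrA mulrCA divff ?mulr1; last by rewrite !mulf_neq0 ?gt_eqF ?pi_gt0.
apply/eqP; rewrite eq_sym -subr_eq0 addrC -mulNr; apply/eqP; apply: h.
- move=> x; apply: cvgD; apply: cvgM; try exact: cvg_cst.
  + apply: cvgM; last exact: continuous_sinM.
    by apply: cvgM => //; exact: continuous_gauss.
  + by apply: cvgM; [exact: continuous_gauss|exact: continuous_cosM].
- move=> x; have := is_deriveM (is_derive_gauss B x) (is_derive_sinM th x).
  by move=> /is_derive_eq; apply; rewrite /GRing.scale /=; ring.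
- exact: (integrableD measurableT i1' i2').
Qed.

Lemma Rintegral_id_gauss_cos B th : 0 < B ->
  (\int[mu]_x (x * gauss B x * cos (th * x)))%R = - (th / (2 * pi * B)) * gauss_sin B th.
Proof.
move=> B0.
have i1 := integrable_id_gauss_mul B0 (measurable_cosM th) (fun x => abs_cos_le1 _).
have i2 := integrable_gauss_mul B0 (measurable_sinM th) (fun x => abs_sin_le1 _).
have i1' : mu.-integrable setT (EFin \o (fun x => - (2 * pi * B) * (x * gauss B x * cos (th * x)))).
  exact: (integrableZl measurableT _ i1).
have i2' : mu.-integrable setT (EFin \o (fun x => - th * (gauss B x * sin (th * x)))).
  exact: (integrableZl measurableT _ i2).
have [l1 l2] := gauss_cvg0 B0 (fun x => abs_cos_le1 (th * x)).
have := @Rintegral_derive_eq0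
  (fun x => - (2 * pi * B) * (x * gauss B x * cos (th * x)) + - th * (gauss B x * sin (th * x)))
  (fun x => gauss B x * cos (th * x)) _ _ _ l1 l2.
rewrite RintegralD//= RintegralZl//= RintegralZl//= -/(gauss_sin B th) => h.
apply: (@mulfI _ (2 * pi * B)); first by rewrite !mulf_neq0 ?gt_eqF ?pi_gt0.
rewrite mulrA mulrN mulrCA divff ?mulr1; last by rewrite !mulf_neq0 ?gt_eqF ?pi_gt0.
apply/eqP; rewrite eq_sym -subr_eq0 addrC -mulNr; apply/eqP; apply: h.
- move=> x; apply: cvgD; apply: cvgM; try exact: cvg_cst.
  + apply: cvgM; last exact: continuous_cosM.
    by apply: cvgM => //; exact: continuous_gauss.
  + by apply: cvgM; [exact: continuous_gauss|exact: continuous_sinM].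
- move=> x; have := is_deriveM (is_derive_gauss B x) (is_derive_cosM th x).
  by move=> /is_derive_eq; apply; rewrite /GRing.scale /=; ring.
- exact: (integrableD measurableT i1' i2').
Qed.

(** Differentiation under the integral sign, with the majorant |y| [gauss B y], which does not
    depend on the parameter. The abstract [c] covers cosine and sine at once. *)
Lemma is_derive_Rintegral_gauss B (c c' : R -> R) th : 0 < B ->
  (forall x, is_derive x 1 c (c' x)) -> (forall th, measurable_fun setT (fun x => c (th * x))) ->
  (forall x, `|c x| <= 1) -> (forall x, `|c' x| <= 1) ->
  is_derive th 1 (fun th => (\int[mu]_x (gauss B x * c (th * x)))%R)
    (\int[mu]_x (x * gauss B x * c' (th * x)))%R.
Proof.
move=> B0 dc mc c1 c'1.
have d y x : is_derive x 1 (fun th => gauss B y * c (th * y)) (y * gauss B y * c' (x * y)).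
  rewrite (_ : (fun _ => _) = gauss B y *: (c \o (y *: @id R))); last first.
    by apply/funext => z; rewrite /= [z * y]mulrC.
  have di : is_derive x 1 (y *: @id R) y.
    by apply: is_derive_eq; rewrite /GRing.scale /= mulr1.
  have dcc : is_derive x 1 (c \o (y *: @id R)) (c' (y * x) * y).
    exact: is_derive1_comp.
  by apply: is_derive_eq; rewrite /GRing.scale /= [x * y]mulrC; ring.
have pE y x : partial1of2 (fun th y => gauss B y * c (th * y)) x y = y * gauss B y * c' (x * y).
  by rewrite partial1of2E; case: (d y x).
(* The factor [cst 1] only brings the majorant into the shape of [integrable_id_gauss_mul]. *)
have G : mu.-integrable setT (EFin \o (fun x => `|x * gauss B x * cst 1 x|)).
  have n1 (x : R) : `|cst 1 x : R| <= 1 by rewrite normr1.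
  exact: integrable_abse (integrable_id_gauss_mul B0 (measurable_cst (1 : R)) n1).
have thI : `]th - 1, th + 1[%classic th by rewrite /= in_itv /= ltrBlDr ltrDl ltr01.
have Iint (x : R) : `]th - 1, th + 1[%classic x ->
    mu.-integrable setT (EFin \o (fun y => gauss B y * c (x * y))).
  by move=> _; apply: integrable_gauss_mul.
have Ider (x y : R) : `]th - 1, th + 1[%classic x -> [set: R] y ->
  derivable (fun th => gauss B y * c (th * y)) x 1.
  by move=> _ _; case: (d y x).
have Gub (x y : R) : `]th - 1, th + 1[%classic x -> [set: R] y ->
    `|partial1of2 (fun th y => gauss B y * c (th * y)) x y| <= `|y * gauss B y * cst 1 y|.
  by move=> _ _; rewrite pE !normrM normr1 mulr1 ler_piMr// mulr_ge0.
apply: DeriveDef.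
  exact: (derivable_under_integral measurableT thI Iint Ider (fun _ => normr_ge0 _) G Gub).
rewrite -derive1E.
have -> := differentiation_under_integral measurableT thI Iint Ider (fun _ => normr_ge0 _) G Gub.
by apply: eq_Rintegral => y _; rewrite pE.
Qed.

(** The integrating factor exp(th^2 / (4 pi B)) turns f into a function of zero derivative. *)
Let gauss_ode (f : R -> R) B th : 0 < B ->
  (forall th : R, is_derive th 1 f (- (th / (2 * pi * B)) * f th)) ->
  f th = f 0 * expR (- (th ^+ 2 / (4 * pi * B))).
Proof.
move=> B0 df; have p0 := pi_gt0 R.
pose k := (4 * pi * B)^-1.
have d x : is_derive x 1 (f * (expR \o (k *: (@id R ^+ 2)))) 0.
  apply: is_derive_eq; rewrite /GRing.scale /= expr1 /GRing.scale /= /k.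
  by move: (pi : R) p0 => p p0; field; rewrite !gt_eqF.
have := is_derive_0_is_cst th 0 d.
rewrite /= !fctE /= expr0n /= scaler0 expR0 mulr1 => <-.
have -> : k *: th ^+ 2 = th ^+ 2 / (4 * pi * B) by rewrite /k /GRing.scale /= mulrC.
by rewrite -[RHS]mulrA -expRD -(mulrA 4) subrr expR0 mulr1.
Qed.

(** Differentiating under the integral and integrating by parts shows that the transform solves a
    linear first-order equation in th; its value at 0 is the Gaussian integral. *)
Lemma gauss_cosE B th : 0 < B ->
  gauss_cos B th = (Num.sqrt B)^-1 * expR (- (th ^+ 2 / (4 * pi * B))).
Proof.
move=> B0.
have d x : is_derive x 1 (gauss_cos B) (- (x / (2 * pi * B)) * gauss_cos B x).
  have -> : - (x / (2 * pi * B)) * gauss_cos B x =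
      (\int[mu]_y (y * gauss B y * (- sin (x * y))))%R.
    rewrite mulNr -Rintegral_id_gauss_sin// -mulN1r -RintegralZl//.
      by apply: eq_Rintegral => y _; rewrite mulN1r mulrN.
    exact: integrable_id_gauss_mul (measurable_sinM _) (fun x => abs_sin_le1 _).
  apply: (is_derive_Rintegral_gauss (c' := fun x => - sin x)) => //.
  - exact: measurable_cosM.
  - exact: abs_cos_le1.
  - by move=> y; rewrite normrN abs_sin_le1.
rewrite (gauss_ode _ B0 d); congr *%R.
rewrite -Rintegral_gauss//; apply: eq_Rintegral => x _.
by rewrite mul0r cos0 mulr1.
Qed.

(** The same equation with initial value 0, in place of a parity argument. *)
Lemma gauss_sinE B th : 0 < B -> gauss_sin B th = 0.
Proof.
move=> B0.
have d x : is_derive x 1 (gauss_sin B) (- (x / (2 * pi * B)) * gauss_sin B x).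
  rewrite -Rintegral_id_gauss_cos//.
  apply: is_derive_Rintegral_gauss => //.
  - exact: measurable_sinM.
  - exact: abs_sin_le1.
  - exact: abs_cos_le1.
rewrite (gauss_ode _ B0 d).
rewrite /gauss_sin; under eq_Rintegral do rewrite mul0r sin0 mulr0.
by rewrite Rintegral_cst// !mul0r.
Qed.

End GaussianFourier1.

(** * Wave packets are Schwartz functions *)

Section GaussianSchwartz.
Context {R : realType}.
Implicit Types (A B a b : R) (p v : R * R) (f g : R * R -> R).

Let continuous_fst : continuous (fst : R * R -> R).
Proof. move=> p; exact: cvg_fst. Qed.

Let continuous_snd : continuous (snd : R * R -> R).
Proof. move=> p; exact: cvg_snd. Qed.

Let differentiable_fst p : differentiable (fst : R * R -> R) p.
Proof. by apply: linear_differentiable; exact: continuous_fst. Qed.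

Let differentiable_snd p : differentiable (snd : R * R -> R) p.
Proof. by apply: linear_differentiable; exact: continuous_snd. Qed.

Let is_derive_fst p v : is_derive p v (fst : R * R -> R) v.1.
Proof.
apply: DeriveDef; first exact/diff_derivable/differentiable_fst.
by rewrite deriveE// diff_lin.
Qed.

Let is_derive_snd p v : is_derive p v (snd : R * R -> R) v.2.
Proof.
apply: DeriveDef; first exact/diff_derivable/differentiable_snd.
by rewrite deriveE// diff_lin.
Qed.

Lemma is_derive_compR f (h : R -> R) p v (df dh : R) : differentiable f p ->
  is_derive p v f df -> is_derive (f p) 1 h dh ->
  differentiable (h \o f) p /\ is_derive p v (h \o f) (dh * df).
Proof.
move=> dif [_ <-] [/derivable1_diffP dih <-].
have d : differentiable (h \o f) p by exact: differentiable_comp.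
split => //; apply: DeriveDef; first exact/diff_derivable.
rewrite deriveE// diff_comp// diff1E//= derive1E (deriveE _ dif).
by rewrite mulrC.
Qed.

(** A class of coefficients stable under every directional derivative, also after multiplication by
    a Gaussian. All derivatives of a packet, and their products with monomials, have the form
    [trig_poly] times [gauss2]. *)
Inductive trig_poly : (R * R -> R) -> Prop :=
| TrigCst c : trig_poly (cst c)
| TrigFst : trig_poly fst
| TrigSnd : trig_poly snd
| TrigCos a b : trig_poly (fun p => cos (a * p.1 + b * p.2))
| TrigSin a b : trig_poly (fun p => sin (a * p.1 + b * p.2))
| TrigAdd f g : trig_poly f -> trig_poly g -> trig_poly (f + g)
| TrigMul f g : trig_poly f -> trig_poly g -> trig_poly (f * g).

Lemma is_derive_lin a b p v : let l := (a *: fst + b *: snd) : R * R -> R in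
  differentiable l p /\ is_derive p v l (a * v.1 + b * v.2).
Proof.
move=> l; split.
- apply: differentiableD; apply: differentiableZ.
  + exact: differentiable_fst.
  + exact: differentiable_snd.
- exact: (is_deriveD (is_deriveZ a (is_derive_fst p v)) (is_deriveZ b (is_derive_snd p v))).
Qed.

Lemma trig_poly_derive f v : trig_poly f ->
  exists2 f', trig_poly f' &
    forall p, differentiable f p /\ is_derive p v f (f' p).
Proof.
elim => {f} [c|||a b|a b|f g tf [f' tf' df] tg [g' tg' dg]|f g tf [f' tf' df] tg [g' tg' dg]].
- by exists (cst 0); [exact: TrigCst|move=> p; split => //; exact: is_derive_cst].
- by exists (cst v.1); [exact: TrigCst|move=> p; split].
- by exists (cst v.2); [exact: TrigCst|move=> p; split].
- exists (cst (- (a * v.1 + b * v.2)) * (fun p => sin (a * p.1 + b * p.2))).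
    by apply: TrigMul; [exact: TrigCst|exact: TrigSin].
  move=> p; have [dl il] := is_derive_lin a b p v.
  have [d i] := is_derive_compR dl il (is_derive_cos _); split; first exact: d.
  by apply: (is_derive_eq i); rewrite /= mulNr mulrC -mulNr.
- exists (cst (a * v.1 + b * v.2) * (fun p => cos (a * p.1 + b * p.2))).
    by apply: TrigMul; [exact: TrigCst|exact: TrigCos].
  move=> p; have [dl il] := is_derive_lin a b p v.
  have [d i] := is_derive_compR dl il (is_derive_sin _); split; first exact: d.
  by apply: (is_derive_eq i); rewrite /= mulrC.
- exists (f' + g'); first exact: TrigAdd.
  move=> p; have [[? ?] [? ?]] := (df p, dg p).
  by split; [exact: differentiableD|exact: is_deriveD].
- exists (f * g' + g * f').
    by apply: TrigAdd; exact: TrigMul.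
  move=> p; have [[? ?] [? ?]] := (df p, dg p).
  by split; [exact: differentiableM|exact: is_deriveM].
Qed.

(** Growth at an arbitrarily small Gaussian rate d, so that any decaying Gaussian beats it. *)
Lemma trig_poly_bound f d : trig_poly f -> 0 < d ->
  exists2 M, 0 < M & forall p, `|f p| <= M * expR (d * (p.1 ^+ 2 + p.2 ^+ 2)).
Proof.
have expge1 d' (p : R * R) : 0 < d' -> 1 <= expR (d' * (p.1 ^+ 2 + p.2 ^+ 2)).
  by move=> d0; rewrite -expR0 ler_expR mulr_ge0 ?addr_ge0 ?sqr_ge0 ?ltW.
have idb d' (x y : R) : 0 < d' -> `|x| <= (1 + d'^-1) * expR (d' * (x ^+ 2 + y ^+ 2)).
  move=> d0; have di : 0 < d'^-1 by rewrite invr_gt0.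
  apply: (@le_trans _ _ ((1 + d'^-1) * (1 + d' * (x ^+ 2 + y ^+ 2)))); last first.
    by rewrite ler_wpM2l ?expR_ge1Dx// addr_ge0// ltW.
  have -> : (1 + d'^-1) * (1 + d' * (x ^+ 2 + y ^+ 2)) =
      1 + x ^+ 2 + (y ^+ 2 + d'^-1 + d' * (x ^+ 2 + y ^+ 2)).
    by field; rewrite gt_eqF.
  apply: (@le_trans _ _ (1 + x ^+ 2)).
    by rewrite -real_normK ?num_real//; have := sqr_ge0 (`|x| - 1); nra.
  by rewrite lerDl !addr_ge0 ?sqr_ge0 ?mulr_ge0 ?addr_ge0 ?sqr_ge0// ltW.
(* The rate stays universally quantified in the induction because a product gives d/2 to each
   factor. *)
move=> tf; elim: tf d => {f} [c|||a b|a b|f g tf hf tg hg|f g tf hf tg hg] d d0.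
- exists (`|c| + 1); first by rewrite ltr_wpDl.
  move=> p; apply: (@le_trans _ _ (`|c| + 1)); first by rewrite lerDl.
  by rewrite ler_peMr// ?addr_ge0//; exact: expge1.
- exists (1 + d^-1); first by rewrite addr_gt0 ?invr_gt0.
  by move=> p; exact: idb.
- exists (1 + d^-1); first by rewrite addr_gt0 ?invr_gt0.
  by move=> p; rewrite addrC [_ + p.2 ^+ 2]addrC [d^-1 + _]addrC; exact: idb.
- exists 1 => // p; rewrite mul1r (le_trans (abs_cos_le1 _))//; exact: expge1.
- exists 1 => // p; rewrite mul1r (le_trans (abs_sin_le1 _))//; exact: expge1.
- have [M M0 hM] := hf d d0; have [N N0 hN] := hg d d0.
  exists (M + N); first by rewrite addr_gt0.
  by move=> p; rewrite mulrDl (le_trans (ler_normD _ _))// lerD.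
- have d20 : 0 < d / 2 by rewrite divr_gt0.
  have [M M0 hM] := hf _ d20; have [N N0 hN] := hg _ d20.
  exists (M * N); first by rewrite mulr_gt0.
  move=> p; have -> : d * (p.1 ^+ 2 + p.2 ^+ 2) =
      d / 2 * (p.1 ^+ 2 + p.2 ^+ 2) + d / 2 * (p.1 ^+ 2 + p.2 ^+ 2) by field.
  by rewrite expRD mulrACA normrM ler_pM.
Qed.

Definition gauss2 A B p : R := gauss A p.1 * gauss B p.2.

Lemma gauss2_ge0 A B p : 0 <= gauss2 A B p.
Proof. by rewrite mulr_ge0 ?gauss_ge0. Qed.

Lemma is_derive_gauss2 A B p v : differentiable (gauss2 A B) p /\
  is_derive p v (gauss2 A B)
    (- (2 * pi) * (A * p.1 * v.1 + B * p.2 * v.2) * gauss2 A B p).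
Proof.
have [d1 i1] := is_derive_compR (differentiable_fst p) (is_derive_fst p v)
  (is_derive_gauss A _).
have [d2 i2] := is_derive_compR (differentiable_snd p) (is_derive_snd p v)
  (is_derive_gauss B _).
split; first exact: (differentiableM d1 d2).
apply: (is_derive_eq (is_deriveM i1 i2)).
by rewrite /GRing.scale /= /gauss2; ring.
Qed.

Lemma trig_poly_gauss_derive A B f v : trig_poly f ->
  exists2 f', trig_poly f' &
    forall p, differentiable (f * gauss2 A B) p /\
      is_derive p v (f * gauss2 A B) ((f' * gauss2 A B) p).
Proof.
move=> tf; have [f' tf' df] := trig_poly_derive v tf.
exists (f' + cst (- (2 * pi)) * (cst (A * v.1) * fst + cst (B * v.2) * snd) * f).
  apply: TrigAdd => //; apply: TrigMul => //.
  apply: TrigMul; first exact: TrigCst.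
  by apply: TrigAdd; apply: TrigMul; try exact: TrigCst;
    [exact: TrigFst|exact: TrigSnd].
move=> p; have [? ?] := df p; have [d2 i2] := is_derive_gauss2 A B p v.
split; first exact: differentiableM.
apply: (is_derive_eq (is_deriveM _ i2)).
by rewrite /GRing.scale /= !fctE /=; ring.
Qed.

(** By induction every iterated derivative is a [trig_poly] times the same Gaussian; the monomial in
    the Schwartz seminorm is absorbed into the [trig_poly]. *)
Lemma trig_poly_gauss_schwartz A B f : 0 < A -> 0 < B -> trig_poly f ->
  schwartz_real (f * gauss2 A B).
Proof.
move=> A0 B0 tf.
have step v g : trig_poly g -> exists2 g', trig_poly g' &
    (fun p => 'D_v (g * gauss2 A B) p) = g' * gauss2 A B.
  move=> tg; have [g' tg' dg] := trig_poly_gauss_derive A B v tg.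
  by exists g' => //; apply/funext => p; have [_ [_ <-]] := dg p.
have iterE j k : exists2 g, trig_poly g &
    iter j (@dt R) (iter k (@dx R) (f * gauss2 A B)) = g * gauss2 A B.
  elim: j => [|j [g tg]].
    elim: k => [|k [g tg]]; first by exists f.
    by rewrite /= => ->; exact: step.
  by rewrite iterS => ->; exact: step.
move=> j k; have [g tg ->] := iterE j k; split => [p|m n].
  (* The direction 0 is a dummy: only the differentiability is extracted. *)
  by have [g' _ dg] := trig_poly_gauss_derive A B 0 tg; have [] := dg p.
have tX (h : R * R -> R) i : trig_poly h -> trig_poly (h ^+ i).
  move=> th; elim: i => [|i IH]; first exact: TrigCst.
  by rewrite exprS; exact: TrigMul.
have m0 : 0 < Num.min A B by rewrite lt_min A0.
(* The rate pi min(A, B) is the largest radial rate that the Gaussian cancels in both variables. *)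
have [M M0 hM] := @trig_poly_bound (fst ^+ m * snd ^+ n * g) (pi * Num.min A B)
  (TrigMul (TrigMul (tX _ m TrigFst) (tX _ n TrigSnd)) tg)
  (mulr_gt0 (pi_gt0 R) m0).
exists M => p.
rewrite [X in `|X|](_ : _ = (fst ^+ m * snd ^+ n * g) p * gauss2 A B p); last first.
  by rewrite /= !fctE /= mulrA.
rewrite normrM (ger0_norm (gauss2_ge0 _ _ _)).
apply: (@le_trans _ _ (M * expR (pi * Num.min A B * (p.1 ^+ 2 + p.2 ^+ 2)) * gauss2 A B p)).
  by rewrite ler_wpM2r ?gauss2_ge0.
rewrite /gauss2 /gauss -mulrA -!expRD ler_piMr ?(ltW M0)//.
rewrite -expR0 ler_expR.
have p0 := pi_gt0 R.
have h1 : Num.min A B * p.1 ^+ 2 <= A * p.1 ^+ 2.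
  by rewrite ler_wpM2r ?sqr_ge0// ge_min lexx.
have h2 : Num.min A B * p.2 ^+ 2 <= B * p.2 ^+ 2.
  by rewrite ler_wpM2r ?sqr_ge0// ge_min lexx orbT.
have -> : forall m : R, pi * m * (p.1 ^+ 2 + p.2 ^+ 2) + (- (pi * A * p.1 ^+ 2) - pi * B * p.2 ^+ 2)
  = pi * ((m * p.1 ^+ 2 - A * p.1 ^+ 2) + (m * p.2 ^+ 2 - B * p.2 ^+ 2)).
  by move=> m'; ring.
by rewrite pmulr_rle0// -[leRHS]addr0 lerD// subr_le0.
Qed.

End GaussianSchwartz.

(** * Fourier transform of wave packets *)

Section GaussianFourier2.
Context {R : realType}.
Implicit Types (A B a b : R) (p q : R * R).
Notation mu := (@lebesgue_measure R).

Let measurable_prod_mul (f g : R -> R) : measurable_fun setT f ->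
  measurable_fun setT g -> measurable_fun setT (fun p => f p.1 * g p.2).
Proof.
move=> mf mg; apply: measurable_funM.
- exact: (measurableT_comp mf measurable_fst).
- exact: (measurableT_comp mg measurable_snd).
Qed.

Lemma integrable_prod_mul (f g : R -> R) : mu.-integrable setT (EFin \o f) ->
  mu.-integrable setT (EFin \o g) ->
  (mu \x mu)%E.-integrable setT (EFin \o (fun p => f p.1 * g p.2)).
Proof.
move=> /integrableP[/measurable_EFinP mf if_] /integrableP[/measurable_EFinP mg ig].
apply/integrable12ltyP; first by apply/measurable_EFinP; exact: measurable_prod_mul.
have -> : (\int[mu]_x \int[mu]_y `|(EFin \o (fun p => (f p.1 * g p.2)%R)) (x, y)| =
    \int[mu]_x (`|(f x)%:E| * \int[mu]_y `|(g y)%:E|))%E.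
  apply: eq_integral => x _; rewrite -ge0_integralZl//.
    by apply: eq_integral => y _ /=; rewrite normrM EFinM.
  by apply: measurableT_comp => //; exact/measurable_EFinP.
have n0 (k : R -> R) : (0 <= \int[mu]_x `|(k x)%:E|)%E.
  by apply: integral_ge0 => x _; exact: abse_ge0.
rewrite ge0_integralZr//.
- by apply: lte_mul_pinfty => //; rewrite ge0_fin_numE.
- by apply: measurableT_comp => //; exact/measurable_EFinP.
Qed.

Lemma Rintegral_prod_mul (f g : R -> R) : mu.-integrable setT (EFin \o f) ->
  mu.-integrable setT (EFin \o g) ->
  (\int[(mu \x mu)%E]_p (f p.1 * g p.2))%R =
  (\int[mu]_x f x)%R * (\int[mu]_x g x)%R.
Proof.
move=> fi gi; rewrite /Rintegral -integral12_prod_meas1//; last exact: integrable_prod_mul.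
rewrite /fubini_F /= -fineM; [|exact: integrable_fin_num..].
congr fine; rewrite -[X in (_ * X)%E]fineK; last exact: integrable_fin_num.
rewrite -integralZr//; apply: eq_integral => x _.
rewrite fineK; last exact: integrable_fin_num.
rewrite -integralZl//; exact: eq_integral.
Qed.

Section Oscillatory.
Context (A a b : R) (h : R -> R) (A0 : 0 < A)
  (hc : mu.-integrable setT (EFin \o (fun x => h x * cos (b * x))))
  (hs : mu.-integrable setT (EFin \o (fun x => h x * sin (b * x)))).

Let gc : mu.-integrable setT (EFin \o (fun x => gauss A x * cos (a * x))).
Proof. exact: integrable_gauss_mul A0 (measurable_cosM a) (fun x => abs_cos_le1 _). Qed.

Let gs : mu.-integrable setT (EFin \o (fun x => gauss A x * sin (a * x))).
Proof. exact: integrable_gauss_mul A0 (measurable_sinM a) (fun x => abs_sin_le1 _). Qed.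

Let cosE : (fun p => gauss A p.1 * h p.2 * cos (a * p.1 + b * p.2)) =
  (fun p => (fun x => gauss A x * cos (a * x)) p.1 * (fun x => h x * cos (b * x)) p.2 -
    (fun x => gauss A x * sin (a * x)) p.1 * (fun x => h x * sin (b * x)) p.2).
Proof. by apply/funext => p /=; rewrite cosD; ring. Qed.

Let sinE : (fun p => gauss A p.1 * h p.2 * sin (a * p.1 + b * p.2)) =
  (fun p => (fun x => gauss A x * sin (a * x)) p.1 * (fun x => h x * cos (b * x)) p.2 +
    (fun x => gauss A x * cos (a * x)) p.1 * (fun x => h x * sin (b * x)) p.2).
Proof. by apply/funext => p /=; rewrite sinD; ring. Qed.

Lemma integrable_gauss_osc_cos : (mu \x mu)%E.-integrable setT
  (EFin \o (fun p => gauss A p.1 * h p.2 * cos (a * p.1 + b * p.2))).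
Proof.
rewrite cosE; exact: (integrableB measurableT (integrable_prod_mul gc hc)
  (integrable_prod_mul gs hs)).
Qed.

Lemma integrable_gauss_osc_sin : (mu \x mu)%E.-integrable setT
  (EFin \o (fun p => gauss A p.1 * h p.2 * sin (a * p.1 + b * p.2))).
Proof.
rewrite sinE; exact: (integrableD measurableT (integrable_prod_mul gs hc)
  (integrable_prod_mul gc hs)).
Qed.

(** The addition formula splits the integrand into tensor products, and those with a sine in the
    first variable vanish. The factor [h] will be [gauss B] for a packet and x [gauss B] for its
    x-derivative. *)
Lemma Rintegral_gauss_osc_cos :
  (\int[(mu \x mu)%E]_p (gauss A p.1 * h p.2 * cos (a * p.1 + b * p.2)))%R =
  gauss_cos A a * (\int[mu]_x (h x * cos (b * x)))%R.
Proof.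
rewrite cosE (RintegralB measurableT (integrable_prod_mul gc hc)
  (integrable_prod_mul gs hs)).
by rewrite (Rintegral_prod_mul gc hc) (Rintegral_prod_mul gs hs) -/(gauss_sin A a) gauss_sinE// mul0r subr0.
Qed.

Lemma Rintegral_gauss_osc_sin :
  (\int[(mu \x mu)%E]_p (gauss A p.1 * h p.2 * sin (a * p.1 + b * p.2)))%R =
  gauss_cos A a * (\int[mu]_x (h x * sin (b * x)))%R.
Proof.
rewrite sinE (RintegralD measurableT (integrable_prod_mul gs hc)
  (integrable_prod_mul gc hs)).
by rewrite (Rintegral_prod_mul gs hc) (Rintegral_prod_mul gc hs) -/(gauss_sin A a) gauss_sinE// mul0r add0r.
Qed.

End Oscillatory.

(** The Gaussian modulated by e^{2 pi i (al t + be x)}: in frequency it is centred at (al, be) with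
    widths of order A^{1/2} and B^{1/2}, so A = 1 and B = L^{-2} give widths 1 and 1/L. *)
Definition wave A B al be p : R[i] :=
  (gauss2 A B p * cos (2 * pi * al * p.1 + 2 * pi * be * p.2) +i*
   (gauss2 A B p * sin (2 * pi * al * p.1 + 2 * pi * be * p.2)))%C.

Lemma schwartz_wave A B al be : 0 < A -> 0 < B -> schwartz (wave A B al be).
Proof.
move=> A0 B0; split.
- rewrite (_ : re_part _ = (fun p => cos (2 * pi * al * p.1 + 2 * pi * be * p.2)) *
    gauss2 A B); first by apply: trig_poly_gauss_schwartz => //; exact: TrigCos.
  by apply/funext => p; rewrite /re_part /= mulrC.
- rewrite (_ : im_part _ = (fun p => sin (2 * pi * al * p.1 + 2 * pi * be * p.2)) *
    gauss2 A B); first by apply: trig_poly_gauss_schwartz => //; exact: TrigSin.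
  by apply/funext => p; rewrite /im_part /= mulrC.
Qed.

Lemma waveM A B al be A' B' al' be' p :
  wave A B al be p * wave A' B' al' be' p =
  wave (A + A') (B + B') (al + al') (be + be') p.
Proof.
rewrite /wave; simpc.
have -> : gauss2 (A + A') (B + B') p = gauss2 A B p * gauss2 A' B' p.
  by rewrite /gauss2 -(gaussM A A') -(gaussM B B') mulrACA.
have -> : 2 * pi * (al + al') * p.1 + 2 * pi * (be + be') * p.2 =
  (2 * pi * al * p.1 + 2 * pi * be * p.2) + (2 * pi * al' * p.1 + 2 * pi * be' * p.2).
  by ring.
set X := _ * p.1 + _; set Y := 2 * pi * al' * p.1 + _.
by rewrite [cos (X + Y)]cosD [sin (X + Y)]sinD; congr (_ +i* _)%C; ring.
Qed.

(** The packet at frequency 0 is real, so using it as u2 makes the conjugation in (E1) harmless. *)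
Lemma conj_wave0 A B p : (wave A B 0 0 p)^*%C = wave A B 0 0 p.
Proof. by rewrite /wave !mulr0 !mul0r addr0 sin0 !mulr0 /= oppr0. Qed.

Definition gauss_hat A B al be q : R :=
  (Num.sqrt A)^-1 * (Num.sqrt B)^-1 * (gauss A^-1 (q.1 - al) * gauss B^-1 (q.2 - be)).

Lemma gauss_cos_freq A al x : 0 < A ->
  gauss_cos A (2 * pi * (al - x)) = (Num.sqrt A)^-1 * gauss A^-1 (x - al).
Proof.
move=> A0; rewrite gauss_cosE//; congr (_ * expR _).
by move: (pi : R) (pi_gt0 R) => c c0; field; rewrite !gt_eqF.
Qed.

(** Both sides are a Gaussian times c + i d times a plane wave, the Fourier kernel shifting the
    frequency. The choice c = 1, d = 0 gives the packet; c = -2 pi B x, d = 2 pi be gives its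
    x-derivative. *)
Let osc A B al be q c d p :
  (expi (- (2 * pi * (p.1 * q.1 + p.2 * q.2))) *
  (gauss2 A B p * (c * cos (2 * pi * al * p.1 + 2 * pi * be * p.2) -
                   d * sin (2 * pi * al * p.1 + 2 * pi * be * p.2)) +i*
   (gauss2 A B p * (c * sin (2 * pi * al * p.1 + 2 * pi * be * p.2) +
                    d * cos (2 * pi * al * p.1 + 2 * pi * be * p.2)))))%C =
  (gauss2 A B p * (c * cos (2 * pi * (al - q.1) * p.1 + 2 * pi * (be - q.2) * p.2) -
                   d * sin (2 * pi * (al - q.1) * p.1 + 2 * pi * (be - q.2) * p.2)) +i*
   (gauss2 A B p * (c * sin (2 * pi * (al - q.1) * p.1 + 2 * pi * (be - q.2) * p.2) +
                    d * cos (2 * pi * (al - q.1) * p.1 + 2 * pi * (be - q.2) * p.2))))%C.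
Proof.
have -> : 2 * pi * (al - q.1) * p.1 + 2 * pi * (be - q.2) * p.2 =
  (2 * pi * al * p.1 + 2 * pi * be * p.2) - (2 * pi * (p.1 * q.1 + p.2 * q.2)).
  by ring.
rewrite cosB sinB /expi cosN sinN; simpc.
by congr (_ +i* _)%C; ring.
Qed.

Lemma fourier_wave A B al be q : 0 < A -> 0 < B ->
  fourier (wave A B al be) q = (gauss_hat A B al be q)%:C%C.
Proof.
move=> A0 B0; rewrite /fourier /re_part /im_part.
have E p : expi (- (2 * pi * (p.1 * q.1 + p.2 * q.2))) * wave A B al be p =
  (gauss A p.1 * gauss B p.2 * cos (2 * pi * (al - q.1) * p.1 + 2 * pi * (be - q.2) * p.2) +i*
   (gauss A p.1 * gauss B p.2 * sin (2 * pi * (al - q.1) * p.1 + 2 * pi * (be - q.2) * p.2)))%C.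
  have := osc A B al be q 1 0 p; rewrite !mul1r !mul0r !subr0 !addr0; exact.
under eq_Rintegral do rewrite E /=.
under [X in (_ +i* X)%C]eq_Rintegral do rewrite E /=.
have hc := integrable_gauss_mul B0 (measurable_cosM (2 * pi * (be - q.2))) (fun x => abs_cos_le1 _).
have hs := integrable_gauss_mul B0 (measurable_sinM (2 * pi * (be - q.2))) (fun x => abs_sin_le1 _).
rewrite Rintegral_gauss_osc_cos// Rintegral_gauss_osc_sin//.
rewrite -/(gauss_cos B _) -/(gauss_sin B _) gauss_sinE// mulr0 !gauss_cos_freq//.
by rewrite mulrACA.
Qed.

Lemma dxC_wave A B al be : dxC (wave A B al be) =
  (fun p => (gauss2 A B p * ((- (2 * pi * B * p.2)) * cos (2 * pi * al * p.1 + 2 * pi * be * p.2) -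
                   (2 * pi * be) * sin (2 * pi * al * p.1 + 2 * pi * be * p.2)) +i*
   (gauss2 A B p * ((- (2 * pi * B * p.2)) * sin (2 * pi * al * p.1 + 2 * pi * be * p.2) +
                    (2 * pi * be) * cos (2 * pi * al * p.1 + 2 * pi * be * p.2))))%C).
Proof.
apply/funext => p; rewrite /dxC /dx.
have [_ ig] := is_derive_gauss2 A B p (0, 1).
have [dl il] := is_derive_lin (2 * pi * al) (2 * pi * be) p (0, 1).
have [_ ic] := is_derive_compR dl il (is_derive_cos _).
have [_ is_] := is_derive_compR dl il (is_derive_sin _).
have [_ mc] := is_deriveM ig ic; have [_ ms] := is_deriveM ig is_.
congr (_ +i* _)%C; [move: mc|move: ms].
- rewrite (_ : _ * _ = re_part (wave A B al be))// => ->.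
  by rewrite /GRing.scale /=; ring.
- rewrite (_ : _ * _ = im_part (wave A B al be))// => ->.
  by rewrite /GRing.scale /=; ring.
Qed.

(** The multiplier 2 pi xi is the sum of -2 pi (be - xi), from differentiating the Gaussian, and 2
    pi be, from differentiating the phase. *)
Lemma fourier_dxC_wave A B al be q : 0 < A -> 0 < B ->
  fourier (dxC (wave A B al be)) q = (0 +i* (2 * pi * q.2 * gauss_hat A B al be q))%C.
Proof.
move=> A0 B0; rewrite /fourier /re_part /im_part dxC_wave.
under eq_Rintegral do rewrite osc /=.
under [X in (_ +i* X)%C]eq_Rintegral do rewrite osc /=.
set a := 2 * pi * (al - q.1); set b := 2 * pi * (be - q.2).
have hc := integrable_gauss_mul B0 (measurable_cosM b) (fun x => abs_cos_le1 _).
have hs := integrable_gauss_mul B0 (measurable_sinM b) (fun x => abs_sin_le1 _).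
have xc := integrable_id_gauss_mul B0 (measurable_cosM b) (fun x => abs_cos_le1 _).
have xs := integrable_id_gauss_mul B0 (measurable_sinM b) (fun x => abs_sin_le1 _).
have Ic := integrable_gauss_osc_cos a A0 hc hs.
have Is := integrable_gauss_osc_sin a A0 hc hs.
have Jc := integrable_gauss_osc_cos a A0 xc xs.
have Js := integrable_gauss_osc_sin a A0 xc xs.
have iZ k (f : R * R -> R) : (mu \x mu)%E.-integrable setT (EFin \o f) ->
    (mu \x mu)%E.-integrable setT (EFin \o (fun p => k * f p)).
  by move=> fi; exact: (integrableZl measurableT k fi).
have Ec := Rintegral_gauss_osc_cos a A0 hc hs.
have Es := Rintegral_gauss_osc_sin a A0 hc hs.
have Fc := Rintegral_gauss_osc_cos a A0 xc xs.
have Fs := Rintegral_gauss_osc_sin a A0 xc xs.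
congr (_ +i* _)%C.
- transitivity (\int[(mu \x mu)%E]_p
    ((- (2 * pi * B)) * (gauss A p.1 * (p.2 * gauss B p.2) * cos (a * p.1 + b * p.2)) -
     2 * pi * be * (gauss A p.1 * gauss B p.2 * sin (a * p.1 + b * p.2)))%R)%R.
    by apply: eq_Rintegral => p _; rewrite /gauss2; ring.
  rewrite RintegralB//; [|exact: iZ _ _ Jc|exact: iZ _ _ Is].
  rewrite !RintegralZl// Fc Es -/(gauss_sin B b) gauss_sinE//.
  by rewrite Rintegral_id_gauss_cos// gauss_sinE// !mulr0 subr0.
- transitivity (\int[(mu \x mu)%E]_p
    ((- (2 * pi * B)) * (gauss A p.1 * (p.2 * gauss B p.2) * sin (a * p.1 + b * p.2)) +
     2 * pi * be * (gauss A p.1 * gauss B p.2 * cos (a * p.1 + b * p.2)))%R)%R.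
    by apply: eq_Rintegral => p _; rewrite /gauss2; ring.
  rewrite RintegralD//; [|exact: iZ _ _ Js|exact: iZ _ _ Ic].
  rewrite !RintegralZl// Fs Ec -/(gauss_cos B b) Rintegral_id_gauss_sin//.
  rewrite /a /b !gauss_cos_freq// /gauss_hat.
  move: (pi : R) (pi_gt0 R) => c c0; field.
  by rewrite !gt_eqF ?sqrtr_gt0.
Qed.

End GaussianFourier2.

(** * Bounds on weighted norms *)

Section L2Bounds.
Context d (T : measurableType d) (R : realType) (mu : {measure set T -> \bar R}).
Implicit Types F G : T -> R.

Let Lnorm2E F : Lnorm mu 2%:E (EFin \o F) =
  ((\int[mu]_q (F q ^+ 2)%:E) `^ 2^-1)%E.
Proof.
rewrite unlock; congr (_ `^ _)%E; apply: eq_integral => q _.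
by rewrite /comp abse_EFin poweR_EFin powR_mulrn// real_normK ?num_real.
Qed.

Let sqr_measurable F : measurable_fun setT F ->
  measurable_fun setT (fun q => (F q ^+ 2)%:E).
Proof. by move=> mF; apply/measurable_EFinP; exact: measurable_funX. Qed.

Let poweR_half (x : R) : 0 <= x -> (x%:E `^ 2^-1)%E = (Num.sqrt x)%:E.
Proof. by move=> x0; rewrite poweR_EFin powR12_sqrt. Qed.

Lemma Lnorm2_le F G (I : R) : measurable_fun setT F -> measurable_fun setT G ->
  (forall q, F q ^+ 2 <= G q) -> (\int[mu]_q (G q)%:E)%E = I%:E ->
  (Lnorm mu 2%:E (EFin \o F) <= (Num.sqrt I)%:E)%E.
Proof.
move=> mF mG FG GI; have G0 q : 0 <= G q by rewrite (le_trans (sqr_ge0 _) (FG q)).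
have I0 : 0 <= I.
  by rewrite -lee_fin -GI integral_ge0// => q _; rewrite lee_fin.
rewrite Lnorm2E -poweR_half//.
have le : (\int[mu]_q (F q ^+ 2)%:E <= I%:E)%E.
  rewrite -GI; apply: ge0_le_integral => //.
  - by move=> q _; rewrite lee_fin sqr_ge0.
  - exact: sqr_measurable.
  - exact/measurable_EFinP.
  - by move=> q _; rewrite lee_fin.
apply: gt0_ler_poweR => //; rewrite in_itv /= leey andbT //.
by apply: integral_ge0 => q _; rewrite lee_fin sqr_ge0.
Qed.

Lemma Lnorm2_ge F (D : set T) (c m : R) : measurable_fun setT F ->
  measurable D -> mu D = m%:E -> 0 <= c -> (forall q, D q -> c <= `|F q|) ->
  ((c * Num.sqrt m)%:E <= Lnorm mu 2%:E (EFin \o F))%E.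
Proof.
move=> mF mD Dm c0 cF.
have m0 : 0 <= m by rewrite -lee_fin -Dm measure_ge0.
have le : ((c ^+ 2 * m)%:E <= \int[mu]_q (F q ^+ 2)%:E)%E.
  apply: (@le_trans _ _ (\int[mu]_(q in D) (F q ^+ 2)%:E)%E); last first.
    apply: ge0_subset_integral => //; first exact: sqr_measurable.
    by move=> q _; rewrite lee_fin sqr_ge0.
  rewrite EFinM -Dm -integral_cst//; apply: ge0_le_integral => //.
  - by move=> q _; rewrite lee_fin sqr_ge0.
  - by apply: measurable_funTS; exact: sqr_measurable.
  - move=> q Dq; rewrite lee_fin -[leRHS]real_normK ?num_real//.
    by rewrite lerXn2r ?nnegrE ?cF.
have -> : c * Num.sqrt m = Num.sqrt (c ^+ 2 * m).
  by rewrite sqrtrM ?sqr_ge0// sqrtr_sqr ger0_norm.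
rewrite -poweR_half ?mulr_ge0 ?sqr_ge0// Lnorm2E.
apply: gt0_ler_poweR => //; rewrite in_itv /= leey andbT ?lee_fin ?mulr_ge0 ?sqr_ge0//.
by apply: integral_ge0 => q _; rewrite lee_fin sqr_ge0.
Qed.

End L2Bounds.

(** * Powers of the Japanese bracket *)

Section Bracket.
Context {R : realType}.
Implicit Types (x y s r : R).

(** The exponent may have either sign: the upper bound on X serves s >= 0, the upper bound on J
    serves s < 0. *)
Lemma powR_comparable (X J c s : R) : 0 < X -> 0 < J -> 0 < c ->
  X <= c * J -> J <= c * X -> X `^ s <= c `^ `|s| * J `^ s.
Proof.
move=> X0 J0 c0 XJ JX; have [s0|s0] := lerP 0 s.
  by rewrite ger0_norm// -(powRM _ (ltW c0) (ltW J0)); apply: ge0_ler_powR => //;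
    rewrite nnegrE ltW// mulr_gt0.
rewrite ltr0_norm// -[s in X `^ s]opprK -[s in J `^ s]opprK.
have t0 : 0 < - s by rewrite oppr_gt0.
move: (- s) t0 => {s s0} t t0.
rewrite !(powRN _ t) -[leLHS]div1r ler_pdivrMr ?powR_gt0// mulrAC.
rewrite ler_pdivlMr ?powR_gt0// mul1r -(powRM _ (ltW c0) (ltW X0)).
by apply: ge0_ler_powR => //; rewrite ?nnegrE ltW// mulr_gt0.
Qed.

Lemma jap_sqr y : jap y ^+ 2 = 1 + y ^+ 2.
Proof. by rewrite /jap sqr_sqrtr real_normK ?num_real// addr_ge0 ?sqr_ge0. Qed.

Lemma jap_gt0 y : 0 < jap y.
Proof. by rewrite sqrtr_gt0 ltr_pwDl ?sqr_ge0. Qed.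

Lemma jap_ge1 y : 1 <= jap y.
Proof. by rewrite -sqrtr1 ler_wsqrtr// lerDl sqr_ge0. Qed.

Lemma japN y : jap (- y) = jap y. Proof. by rewrite /jap normrN. Qed.

Let jap_leP y (c : R) : 0 <= c -> (jap y <= c) = (1 + y ^+ 2 <= c ^+ 2).
Proof. by move=> c0; rewrite -jap_sqr ler_sqr ?nnegrE// ltW// jap_gt0. Qed.

Lemma jap_le y : jap y <= 1 + `|y|.
Proof.
rewrite jap_leP ?addr_ge0// -[y ^+ 2]real_normK ?num_real//.
by have := normr_ge0 y; nra.
Qed.

Lemma le_jap y : `|y| <= jap y.
Proof.
rewrite -ler_sqr ?nnegrE ?(ltW (jap_gt0 _))// jap_sqr real_normK ?num_real//.
by rewrite lerDr.
Qed.

Lemma japD x y : jap (x + y) <= 2 * jap y * jap x.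
Proof.
rewrite jap_leP ?mulr_ge0 ?(ltW (jap_gt0 _))// !exprMn !jap_sqr.
by have := sqr_ge0 (x - y); have := sqr_ge0 (x * y); nra.
Qed.

(** Peetre's inequality. The reverse comparison is [japD] applied to x = (x + y) - y. *)
Lemma jap_powRD x y s :
  jap (x + y) `^ s <= (2 * jap y) `^ `|s| * jap x `^ s.
Proof.
apply: powR_comparable; rewrite ?mulr_gt0 ?jap_gt0//; first exact: japD.
by rewrite -{1}(addrK y x) (le_trans (japD _ _))// japN.
Qed.

(** Raise 1 + w <= (1 + r) exp(w / (1 + r)) to the power r. Dividing by 1 + r instead of r keeps r =
    0 admissible. *)
Lemma powR_expR_bound r : 0 <= r ->
  exists2 C : R, 0 < C & forall w, 0 <= w -> (1 + w) `^ r <= C * expR w.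
Proof.
move=> r0; have r1 : 0 < 1 + r by rewrite ltr_pwDl.
exists ((1 + r) `^ r); first exact: powR_gt0.
move=> w w0.
have h : 1 + w <= (1 + r) * expR (w / (1 + r)).
  apply: (@le_trans _ _ ((1 + r) * (1 + w / (1 + r)))); last first.
    by rewrite ler_wpM2l ?(ltW r1)// expR_ge1Dx.
  have -> : (1 + r) * (1 + w / (1 + r)) = 1 + w + r by field; rewrite gt_eqF.
  by rewrite lerDl.
apply: (@le_trans _ _ (((1 + r) * expR (w / (1 + r))) `^ r)).
  by rewrite ge0_ler_powR ?nnegrE ?addr_ge0 ?mulr_ge0 ?expR_ge0 ?(ltW r1).
rewrite powRM ?expR_ge0 ?(ltW r1)// ler_wpM2l ?powR_ge0// -expRM ler_expR.
by rewrite mulrAC ler_pdivrMr// ler_wpM2l// lerDr.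
Qed.

End Bracket.

(** * Upper and lower norm bounds, uniform in N and L *)

Section WeightedNorm.
Context {R : realType}.
Implicit Types (h : R -> R) (s a al N L K : R) (q : R * R).
Notation mu := (@lebesgue_measure R).

(** Common form of the two norms: h(xi) = xi^2 gives [normX] and h(xi) = nu |xi| xi gives [normY],
    both by conversion. *)
Definition wnorm h s a (f : R * R -> R[i]) : \bar R :=
  Lnorm (mu \x mu)%E 2%:E (fun q =>
    (jap q.2 `^ s * jap (q.1 + h q.2) `^ a * Normc.normc (fourier f q))%:E).

Lemma measurable_jap : measurable_fun setT (@jap R).
Proof.
apply: continuous_measurable_fun => x.
apply: (@continuous_comp _ _ _ (fun y : R => 1 + `|y| ^+ 2) Num.sqrt);
  last exact: sqrt_continuous.
apply: cvgD; first exact: cvg_cst.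
apply: (@continuous_comp _ _ _ (fun y : R => `|y|) (fun y => y ^+ 2));
  last exact: exprn_continuous.
exact: norm_continuous.
Qed.

Lemma measurable_weight h s a (F : R * R -> R) : measurable_fun setT h ->
  measurable_fun setT F ->
  measurable_fun setT (fun q => jap q.2 `^ s * jap (q.1 + h q.2) `^ a * F q).
Proof.
move=> mh mF; apply: measurable_funM => //; apply: measurable_funM.
- apply: (measurableT_comp (measurable_powR s)).
  exact: (measurableT_comp measurable_jap measurable_snd).
- apply: (measurableT_comp (measurable_powR a)).
  apply: (measurableT_comp measurable_jap).
  apply: measurable_funD; first exact: measurable_fst.
  exact: (measurableT_comp mh measurable_snd).
Qed.

Let measurable_gauss_center B m : measurable_fun setT (fun x : R => gauss B (x - m)).
Proof. by apply: (measurableT_comp (measurable_gauss B)); exact: measurable_funB. Qed.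

Lemma measurable_gauss_hat A B al be : measurable_fun setT (@gauss_hat R A B al be).
Proof.
apply: measurable_funM => //; apply: measurable_funM.
- exact: (measurableT_comp (measurable_gauss_center _ _) measurable_fst).
- exact: (measurableT_comp (measurable_gauss_center _ _) measurable_snd).
Qed.

Lemma gauss_hat_ge0 A B al be q : 0 <= gauss_hat A B al be q.
Proof. by rewrite /gauss_hat !mulr_ge0 ?gauss_ge0 ?invr_ge0 ?sqrtr_ge0. Qed.

Let integral_gauss2_center A B al be : 0 < A -> 0 < B ->
  (\int[(mu \x mu)%E]_q (gauss A (q.1 - al) * gauss B (q.2 - be))%:E)%E =
  ((Num.sqrt A)^-1 * (Num.sqrt B)^-1)%:E.
Proof.
move=> A0 B0.
rewrite -integral12_prod_meas1; last first.
  apply: (@integrable_prod_mul _ (fun x => gauss A (x - al)) (fun x => gauss B (x - be)));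
    exact: integrable_gauss_center.
rewrite /fubini_F /=.
under eq_integral => x _.
  under eq_integral do rewrite EFinM.
  rewrite integralZl//; last exact: integrable_gauss_center.
  rewrite integral_gauss_center//.
  over.
rewrite integralZr//; last exact: integrable_gauss_center.
by rewrite integral_gauss_center.
Qed.

(** Here sg and dl are the offsets of tau and xi from the centre and y is the value tau + h(xi). In
    the rescaled offset L dl both weights, relative to <N>^s, are bounded by powers of 1 + sg^2 + (L
    dl)^2, which half of the Gaussian absorbs; hence C depends neither on N nor on L. *)
Let weight_gauss s a K : 0 <= K -> exists2 C, 0 < C &
  forall N L sg dl y, 1 <= L -> `|y| <= `|sg| + K * (`|L * dl| + (L * dl) ^+ 2) ->
  jap (N + dl) `^ s * jap y `^ a * (gauss 1 sg * gauss (L ^+ 2) dl) <=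
  C * jap N `^ s * (gauss 2^-1 sg * gauss (2^-1 * L ^+ 2) dl).
Proof.
move=> K0; have [C C0 hC] := @powR_expR_bound R (`|s| + `|a|) (addr_ge0 (normr_ge0 _) (normr_ge0 _)).
exists (2 `^ `|s| * (2 + 2 * K) `^ `|a| * C).
  by rewrite !mulr_gt0 ?powR_gt0// ltr_pwDl ?mulr_ge0.
move=> N L sg dl y L1 hy; have L0 : 0 < L by exact: lt_le_trans L1.
set eta := L * dl in hy; pose w := sg ^+ 2 + eta ^+ 2.
have w0 : 0 <= w by rewrite addr_ge0 ?sqr_ge0.
have w1 : 0 <= 1 + w by exact: addr_ge0.
have absle (x : R) : `|x| <= 1 + x ^+ 2.
  by rewrite -real_normK ?num_real//; have := sqr_ge0 (`|x| - 1); nra.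
have hdl : jap dl <= 1 + w.
  rewrite -ler_sqr ?nnegrE ?(ltW (jap_gt0 _))// jap_sqr.
  have : dl ^+ 2 <= eta ^+ 2.
    by rewrite exprMn ler_peMl ?sqr_ge0// exprn_ege1.
  by have := sqr_ge0 sg; rewrite /w; nra.
have hyw : jap y <= (2 + 2 * K) * (1 + w).
  apply: (le_trans (jap_le _)).
  have := absle sg; have := absle eta; have := sqr_ge0 sg; have := sqr_ge0 eta.
  by move: hy; rewrite /w; nra.
have K2 : 0 <= 2 + 2 * K by rewrite addr_ge0 ?mulr_ge0.
have h1 : jap (N + dl) `^ s <= 2 `^ `|s| * (1 + w) `^ `|s| * jap N `^ s.
  apply: (le_trans (jap_powRD _ _ _)).
  rewrite powRM ?(ltW (jap_gt0 _))// ler_wpM2r ?powR_ge0// ler_wpM2l ?powR_ge0//.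
  by rewrite ge0_ler_powR ?nnegrE ?(ltW (jap_gt0 _)).
have h2 : jap y `^ a <= (2 + 2 * K) `^ `|a| * (1 + w) `^ `|a|.
  apply: (@le_trans _ _ (jap y `^ `|a|)); first by rewrite ler_powR ?jap_ge1 ?ler_norm.
  rewrite -powRM//.
  by rewrite ge0_ler_powR ?nnegrE ?(ltW (jap_gt0 _))// mulr_ge0.
have h3 : gauss 1 sg * gauss (L ^+ 2) dl =
    gauss 2^-1 sg * gauss (2^-1 * L ^+ 2) dl * expR (- (pi / 2 * w)).
  by rewrite /gauss -!expRD; congr expR; rewrite /w /eta; move: (pi : R) => c; field.
(* The half set aside decays like exp(-pi w / 2), and pi / 2 >= 1 is enough against
   [powR_expR_bound]. *)
have h4 : (1 + w) `^ `|s| * (1 + w) `^ `|a| * expR (- (pi / 2 * w)) <= C.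
  rewrite -powRD; last by apply/implyP => _; rewrite gt_eqF// ltr_pwDl.
  rewrite expRN ler_pdivrMr ?expR_gt0//.
  apply: (le_trans (hC _ w0)); rewrite ler_wpM2l ?(ltW C0)// ler_expR.
  by rewrite ler_peMl// ler_pdivlMr// mul1r pi_ge2.
rewrite h3; set g := gauss _ _ * gauss _ _.
have g0 : 0 <= g by rewrite mulr_ge0 ?gauss_ge0.
apply: (@le_trans _ _ ((2 `^ `|s| * (1 + w) `^ `|s| * jap N `^ s) *
    ((2 + 2 * K) `^ `|a| * (1 + w) `^ `|a|) * (g * expR (- (pi / 2 * w))))).
  by rewrite ler_wpM2r ?mulr_ge0 ?expR_ge0// ler_pM ?powR_ge0.
rewrite [leLHS](_ : _ = 2 `^ `|s| * (2 + 2 * K) `^ `|a| * jap N `^ s * g *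
    ((1 + w) `^ `|s| * (1 + w) `^ `|a| * expR (- (pi / 2 * w)))); last by ring.
rewrite [leRHS](_ : _ = 2 `^ `|s| * (2 + 2 * K) `^ `|a| * jap N `^ s * g * C); last by ring.
by rewrite ler_wpM2l// !mulr_ge0 ?powR_ge0 ?gauss_ge0.
Qed.

(** The condition on al centres the packet on its curve; the bound on h says that the curve leaves
    the centre by at most a quadratic in the rescaled offset. The transform has height L on a set of
    area about 1/L, whence L^{1/2}. *)
Lemma wnorm_wave_le s a K : 0 <= K -> exists2 C, 0 < C &
  forall h al N L, measurable_fun setT h -> al = - h N -> 1 <= L ->
  (forall dl, `|h (N + dl) - h N| <= K * (`|L * dl| + (L * dl) ^+ 2)) ->
  (wnorm h s a (wave 1 (L ^- 2) al N) <= (C * jap N `^ s * Num.sqrt L)%:E)%E.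
Proof.
move=> K0; have [C C0 hC] := weight_gauss s a K0.
exists C => // h al N L mh hal L1 hh; have L0 : 0 < L by exact: lt_le_trans L1.
have Li0 : 0 < L ^- 2 by rewrite invr_gt0 exprn_gt0.
have E q : Normc.normc (fourier (wave 1 (L ^- 2) al N) q) = gauss_hat 1 (L ^- 2) al N q.
  by rewrite fourier_wave//= expr0n /= addr0 sqrtr_sqr ger0_norm// gauss_hat_ge0.
have hatE q : gauss_hat 1 (L ^- 2) al N q =
    L * (gauss 1 (q.1 - al) * gauss (L ^+ 2) (q.2 - N)).
  rewrite /gauss_hat sqrtr1 invr1 mul1r invrK.
  by rewrite sqrtrV ?sqr_ge0// sqrtr_sqr gtr0_norm// invrK.
pose D := C * jap N `^ s * L.
(* Squaring the bound of [weight_gauss] turns the halved exponents back into full ones, and the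
   integral of [G] is exactly D^2 / L. *)
pose G q := D ^+ 2 * (gauss 1 (q.1 - al) * gauss (L ^+ 2) (q.2 - N)).
rewrite /wnorm; under [fun q => _]eq_fun do rewrite E.
have -> : C * jap N `^ s * Num.sqrt L = Num.sqrt (D ^+ 2 * L^-1).
  rewrite sqrtrM ?sqr_ge0// sqrtr_sqr ger0_norm; last first.
    by rewrite !mulr_ge0 ?powR_ge0 ?ltW.
  rewrite /D -[RHS]mulrA sqrtrV ?(ltW L0)//; congr *%R.
  rewrite -{2}(@sqr_sqrtr _ L) ?(ltW L0)// expr2 mulfK//.
  by rewrite gt_eqF// sqrtr_gt0.
pose F q := jap q.2 `^ s * jap (q.1 + h q.2) `^ a * gauss_hat 1 (L ^- 2) al N q.
have := @Lnorm2_le _ _ _ (mu \x mu)%E F G (D ^+ 2 * L^-1); apply.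
- exact: (measurable_weight _ _ mh (measurable_gauss_hat _ _ _ _)).
- apply: measurable_funM => //; apply: measurable_funM.
  + exact: (measurableT_comp (measurable_gauss_center _ _) measurable_fst).
  + exact: (measurableT_comp (measurable_gauss_center _ _) measurable_snd).
- move=> q; have := hC N L (q.1 - al) (q.2 - N) (q.1 + h q.2) L1.
  rewrite subrKC => hq.
  rewrite /F hatE /G.
  have gsqr (B x : R) : gauss B x = gauss (2^-1 * B) x ^+ 2.
    by rewrite /gauss [RHS]expr2 -expRD; congr expR; move: (pi : R) => c; field.
  rewrite [in leRHS](gsqr 1) [in leRHS](gsqr (L ^+ 2)) mulr1 -(exprMn 2 (gauss _ _)).
  rewrite -exprMn ler_sqr ?nnegrE /D; last 2 first.
  + by rewrite !mulr_ge0 ?powR_ge0 ?gauss_ge0 ?ltW.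
  + by rewrite !mulr_ge0 ?powR_ge0 ?gauss_ge0 ?ltW.
  rewrite mulrCA [leRHS]mulrAC [leRHS]mulrC ler_wpM2l ?(ltW L0)//.
  apply: hq.
  have -> : q.1 + h q.2 = (q.1 - al) + (h (N + (q.2 - N)) - h N).
    by rewrite hal subrKC; ring.
  by rewrite (le_trans (ler_normD _ _))// lerD2l.
- rewrite /G; under eq_integral do rewrite EFinM.
  rewrite ge0_integralZl//=; last 3 first.
  + apply/measurable_EFinP; apply: measurable_funM.
      exact: (measurableT_comp (measurable_gauss_center _ _) measurable_fst).
    exact: (measurableT_comp (measurable_gauss_center _ _) measurable_snd).
  + by move=> q _; rewrite lee_fin mulr_ge0 ?gauss_ge0.
  + by rewrite lee_fin sqr_ge0.
  rewrite integral_gauss2_center ?exprn_gt0// sqrtr1 invr1 mul1r sqrtr_sqr.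
  by rewrite gtr0_norm.
Qed.

(** The parameters are those that [waveM] gives for a product of two packets. The prefactor is L/2,
    and on this box of sides 1 and 1/L the exponent is at least -pi. *)
Let gauss_hat_ge al N L q : 1 <= L -> al <= q.1 <= al + 1 -> N <= q.2 <= N + L^-1 ->
  2^-1 * expR (- pi) * L <= gauss_hat (1 + 1) (L ^- 2 + L ^- 2) al N q.
Proof.
move=> L1 q1 q2; have L0 : 0 < L by exact: lt_le_trans L1.
have Ln0 : L != 0 by rewrite gt_eqF.
have -> : gauss_hat (1 + 1) (L ^- 2 + L ^- 2) al N q =
    2^-1 * L * (gauss 2^-1 (q.1 - al) * gauss (2^-1 * L ^+ 2) (q.2 - N)).
  rewrite /gauss_hat; congr (_ * (gauss _ _ * gauss _ _)); last by field.
  rewrite -invfM -sqrtrM ?addr_ge0//.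
  have -> : (1 + 1) * (L ^- 2 + L ^- 2) = (2 / L) ^+ 2 by field.
  by rewrite sqrtr_sqr ger0_norm ?divr_ge0 ?(ltW L0)//; field.
rewrite mulrAC ler_wpM2l ?mulr_ge0 ?(ltW L0)//.
rewrite /gauss -expRD ler_expR.
have h1 : (q.1 - al) ^+ 2 <= 1 by move/andP: q1 => [? ?]; nra.
have h2 : (L * (q.2 - N)) ^+ 2 <= 1.
  move/andP: q2 => [q2 q3].
  have : 0 <= L * (q.2 - N) by rewrite mulr_ge0 ?(ltW L0)// subr_ge0.
  have : L * (q.2 - N) <= 1 by rewrite -ler_pdivlMl// mulr1 lerBlDl.
  by nra.
have -> : - (pi * 2^-1 * (q.1 - al) ^+ 2) - pi * (2^-1 * L ^+ 2) * (q.2 - N) ^+ 2 =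
    - (pi * (2^-1 * ((q.1 - al) ^+ 2 + (L * (q.2 - N)) ^+ 2))).
  by move: (pi : R) => c; field.
rewrite lerN2 ler_piMr ?pi_ge0//.
by rewrite ler_pdivrMl// mulr1 (le_trans (lerD h1 h2)).
Qed.

(** On the box, tau + h(xi) differs from its value at the centre, of size kap N^2, by at most (1 +
    K) N. For large N the weight is therefore comparable to N^2 from both sides, which is what an
    exponent a of unknown sign needs. The factor m makes room for the derivative in (E1). *)
Lemma wnorm_ge s a kap K : 0 < kap -> 0 <= K -> exists2 c, 0 < c & exists2 N0, 1 <= N0 &
  forall h al N L m f F, measurable_fun setT h -> measurable_fun setT F ->
  (forall q, Normc.normc (fourier f q) = F q) -> N0 <= N -> 1 <= L -> 0 <= m ->
  `|al + h N| = kap * N ^+ 2 ->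
  (forall dl, 0 <= dl <= 1 -> `|h (N + dl) - h N| <= K * N) ->
  (forall q, N <= q.2 -> m * gauss_hat (1 + 1) (L ^- 2 + L ^- 2) al N q <= F q) ->
  ((c * m * N `^ s * (N ^+ 2) `^ a * Num.sqrt L)%:E <= wnorm h s a f)%E.
Proof.
(* [cc] serves both comparisons: <y> <= (1 + 2 kap) N^2 and N^2 <= (2 / kap) <y>. *)
move=> k0 K0; pose cc := 1 + 2 * kap + 2 / kap.
have cc0 : 0 < cc by rewrite !addr_gt0 ?divr_gt0 ?mulr_gt0.
exists ((3 `^ `|s|)^-1 * (cc `^ `|a|)^-1 * (2^-1 * expR (- pi))).
  by rewrite !mulr_gt0 ?invr_gt0 ?powR_gt0 ?expR_gt0.
(* This threshold gives (1 + K) N <= (kap / 2) N^2, so at least half of the distance survives. *)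
exists (1 + 2 * (1 + K) / kap).
  by rewrite lerDl divr_ge0 ?mulr_ge0 ?addr_ge0// ltW.
move=> h al N L m f F mh mF fF NN0 L1 m0 hal hh hF.
have L0 : 0 < L by exact: lt_le_trans L1.
have N1 : 1 <= N.
  by apply: le_trans NN0; rewrite lerDl divr_ge0 ?mulr_ge0 ?addr_ge0// ltW.
have N0 : 0 < N by exact: lt_le_trans N1.
have kN : (1 + K) * N <= kap / 2 * N ^+ 2.
  rewrite expr2 mulrA ler_wpM2r ?(ltW N0)//.
  have : 2 * (1 + K) / kap <= N by rewrite (le_trans _ NN0)// lerDr.
  by rewrite ler_pdivrMr// => hN; lra.
pose G q := jap q.2 `^ s * jap (q.1 + h q.2) `^ a * F q.
pose I1 : set R := `[al, al + 1]%classic.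
pose I2 : set R := `[N, N + L^-1]%classic.
rewrite /wnorm; under [fun q => _]eq_fun do rewrite fF.
set c := (3 `^ _)^-1 * _ * _.
have -> : c * m * N `^ s * (N ^+ 2) `^ a * Num.sqrt L =
    (c * m * N `^ s * (N ^+ 2) `^ a * L) * Num.sqrt L^-1.
  rewrite -[RHS]mulrA sqrtrV ?(ltW L0)//; congr (_ * _).
  rewrite -{2}(@sqr_sqrtr _ L) ?(ltW L0)// expr2 mulfK//.
  by rewrite gt_eqF// sqrtr_gt0.
have := @Lnorm2_ge _ _ _ (mu \x mu)%E G (I1 `*` I2)
  (c * m * N `^ s * (N ^+ 2) `^ a * L) L^-1; apply.
- exact: measurable_weight.
- by apply: measurableX; exact: measurable_itv.
- transitivity (mu I1 * mu I2)%E.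
    by apply: product_measure1E; exact: measurable_itv.
  rewrite /I1 /I2 !lebesgue_measure_itv/= !lte_fin !ltrDl ltr01 invr_gt0 L0.
  by rewrite -!EFinB (addrAC al) subrr add0r (addrAC N) subrr add0r mul1e.
- by rewrite !mulr_ge0 ?invr_ge0 ?powR_ge0 ?expR_ge0 ?(ltW L0).
move=> q []; rewrite /I1 /I2 /= !in_itv/= => q1 q2.
have /andP[q2a q2b] := q2; have /andP[q1a q1b] := q1.
have dl1 : q.2 - N <= 1.
  rewrite lerBlDl (le_trans q2b)// lerD2l invf_le1//.
(* The 3 comes from <xi> <= 1 + (N + 1) <= 3 N, using N >= 1. *)
have hj : N `^ s <= 3 `^ `|s| * jap q.2 `^ s.
  apply: powR_comparable => //; first exact: jap_gt0.
  - rewrite (le_trans q2a)// (le_trans (ler_norm _))// (le_trans (le_jap _))//.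
    by rewrite ler_peMl ?(ltW (jap_gt0 _))// ler1n.
  - rewrite (le_trans (jap_le _))// ger0_norm ?(le_trans (ltW N0))//.
    by lra.
have hy : N ^+ 2 <= cc * jap (q.1 + h q.2) /\ jap (q.1 + h q.2) <= cc * N ^+ 2.
  have := hh (q.2 - N); rewrite subr_ge0 q2a dl1 subrKC => /(_ isT) hd.
  set y := q.1 + h q.2.
  have yE : y = (al + h N) + ((q.1 - al) + (h q.2 - h N)) by rewrite /y; ring.
  have hr : `|(q.1 - al) + (h q.2 - h N)| <= kap / 2 * N ^+ 2.
    apply: le_trans kN; rewrite (le_trans (ler_normD _ _))// mulrDl lerD// mul1r.
    by rewrite ger0_norm ?subr_ge0// (le_trans _ N1)// lerBlDl.
  have N21 : 1 <= N ^+ 2 by rewrite exprn_ege1.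
  have ylo : kap / 2 * N ^+ 2 <= `|y|.
    rewrite yE -(opprK (_ - al + _)) (le_trans _ (lerB_dist _ _))// normrN hal.
    by lra.
  have yhi : `|y| <= 2 * kap * N ^+ 2.
    rewrite yE (le_trans (ler_normD _ _))// hal.
    have : 0 <= kap * N ^+ 2 by rewrite mulr_ge0 ?(ltW k0)// sqr_ge0.
    by lra.
  split.
  - apply: (@le_trans _ _ (2 / kap * `|y|)).
      by rewrite -ler_pdivrMl ?divr_gt0// invf_div.
    apply: ler_pM; rewrite ?divr_ge0 ?(ltW k0)// ?le_jap//.
    by rewrite /cc lerDr addr_ge0 ?mulr_ge0 ?(ltW k0).
  - rewrite (le_trans (jap_le _))// /cc !mulrDl mul1r.
    have : 0 <= 2 / kap * N ^+ 2 by rewrite mulr_ge0 ?divr_ge0 ?(ltW k0)// sqr_ge0.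
    by lra.
have hw : (N ^+ 2) `^ a <= cc `^ `|a| * jap (q.1 + h q.2) `^ a.
  by case: hy => hy1 hy2; apply: powR_comparable => //; rewrite ?jap_gt0 ?exprn_gt0.
have hFq : m * (2^-1 * expR (- pi) * L) <= F q.
  by apply: le_trans (hF q q2a); rewrite ler_wpM2l// gauss_hat_ge.
have F0 : 0 <= F q.
  by apply: le_trans hFq; rewrite !mulr_ge0 ?expR_ge0 ?(ltW L0).
rewrite ger0_norm; last by rewrite /G !mulr_ge0 ?powR_ge0.
rewrite /c [leLHS](_ : _ = ((3 `^ `|s|)^-1 * N `^ s) * ((cc `^ `|a|)^-1 * (N ^+ 2) `^ a) *
  (m * (2^-1 * expR (- pi) * L))); last by ring.
have c0 (b x y : R) : 0 < b -> x <= b * y -> b^-1 * x <= y.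
  by move=> b0; rewrite ler_pdivrMl.
apply: ler_pM => //.
- by rewrite !mulr_ge0 ?invr_ge0 ?powR_ge0.
- by rewrite !mulr_ge0 ?expR_ge0 ?(ltW L0).
- by apply: ler_pM; rewrite ?mulr_ge0 ?invr_ge0 ?powR_ge0//;
    apply: c0 => //; exact: powR_gt0.
Qed.

End WeightedNorm.

(** * Counterexamples *)

Section Counterexamples.
Context {R : realType}.
Implicit Types (nu s a b N L C M : R).

Lemma blowup (c M N0 p q : R) : 0 < c -> q < p ->
  ~ (forall N : R, N0 <= N -> 1 <= N -> c * N `^ p <= M * N `^ q).
Proof.
move=> c0 qp h; have e0 : 0 < p - q by rewrite subr_gt0.
(* Since x > M / c, the inequality fails as soon as N^{p - q} >= x. *)
pose x := `|M| / c + 1; have x0 : 0 < x by rewrite ltr_wpDl ?divr_ge0 ?(ltW c0).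
pose N := Num.max 1 (Num.max N0 (x `^ (p - q)^-1)).
have N1 : 1 <= N by rewrite le_max lexx.
have N00 : N0 <= N by rewrite !le_max lexx orbT.
have Nx : x `^ (p - q)^-1 <= N by rewrite !le_max lexx !orbT.
have Np : 0 < N by exact: lt_le_trans N1.
have : x <= N `^ (p - q).
  rewrite -[x]powRr1 ?(ltW x0)// -(mulVf (lt0r_neq0 e0)) powRrM.
  by rewrite ge0_ler_powR ?nnegrE ?powR_ge0 ?(ltW e0) ?(ltW Np).
apply/negP; rewrite -ltNge.
have := h N N00 N1; have -> : N `^ p = N `^ (p - q) * N `^ q.
  by rewrite -powRD ?subrK//; apply/implyP => _; rewrite gt_eqF.
rewrite mulrA ler_pM2r ?powR_gt0// -ler_pdivlMl// mulrC => /le_lt_trans; apply.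
by rewrite /x ltr_pwDr// ler_wpM2r ?invr_ge0 ?(ltW c0)// ler_norm.
Qed.

Lemma sqr_phase_lip (x d : R) : `|(x + d) ^+ 2 - x ^+ 2| <= `|d| * (2 * `|x| + `|d|).
Proof.
have -> : (x + d) ^+ 2 - x ^+ 2 = d * (2 * x + d) by ring.
rewrite normrM ler_wpM2l// (le_trans (ler_normD _ _))// normrM.
by rewrite [`|2|]ger0_norm.
Qed.

(** Splitting the increment of |x| x as |x + d| d + (|x + d| - |x|) x avoids any case distinction on
    signs. *)
Lemma signed_phase_lip nu (x d : R) :
  `|nu * `|x + d| * (x + d) - nu * `|x| * x| <= `|nu| * (`|d| * (2 * `|x| + `|d|)).
Proof.
have -> : nu * `|x + d| * (x + d) - nu * `|x| * x =
    nu * (`|x + d| * d + (`|x + d| - `|x|) * x) by ring.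
rewrite normrM ler_wpM2l// (le_trans (ler_normD _ _))// !normrM normr_id.
have h1 : `|x + d| <= `|x| + `|d| by exact: ler_normD.
have h2 : `| `|x + d| - `|x| | <= `|d|.
  by rewrite (le_trans (ler_dist_dist _ _))// addrC addKr.
have -> : `|d| * (2 * `|x| + `|d|) = (`|x| + `|d|) * `|d| + `|d| * `|x| by ring.
by rewrite lerD// ler_wpM2r.
Qed.

(** Because N <= L, the slope 2N of the curve costs only a multiple of |L d|. The case N = 0 serves
    the packet at frequency 0. *)
Lemma lip_scale N L (d : R) : 0 <= N -> N <= L -> 1 <= L ->
  `|d| * (2 * `|N| + `|d|) <= 2 * (`|L * d| + (L * d) ^+ 2).
Proof.
move=> N0 NL L1; have L0 : 0 <= L by exact: le_trans L1.
rewrite (ger0_norm N0) normrM (ger0_norm L0) exprMn -[d ^+ 2]real_normK ?num_real//.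
have d0 := normr_ge0 d; move: (`|d|) d0 => {}d d0.
have h1 : d * N <= L * d by rewrite mulrC ler_wpM2r.
have h2 : d * d <= L ^+ 2 * d ^+ 2 by rewrite -expr2 ler_peMl ?sqr_ge0// exprn_ege1.
have h3 : 0 <= L ^+ 2 * d ^+ 2 by rewrite mulr_ge0 ?sqr_ge0.
lra.
Qed.

Lemma lip_unit N (d : R) : 1 <= N -> 0 <= d <= 1 -> `|d| * (2 * `|N| + `|d|) <= 3 * N.
Proof.
move=> N1 /andP[d0 d1]; have N0 : 0 <= N by exact: le_trans N1.
rewrite !ger0_norm//; nra.
Qed.

Lemma jap_powR_le N s : 1 <= N -> jap N `^ s <= 2 `^ `|s| * N `^ s.
Proof.
move=> N1; have N0 : 0 < N by exact: lt_le_trans N1.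
apply: powR_comparable => //; first exact: jap_gt0.
- by rewrite (le_trans (jap_le _))// ger0_norm ?(ltW N0)//; lra.
- rewrite (le_trans (ler_norm _))// (le_trans (le_jap _))//.
  by rewrite ler_peMl ?(ltW (jap_gt0 _))// ler1n.
Qed.

Lemma measurable_sqr_phase : measurable_fun setT (fun x : R => x ^+ 2).
Proof. exact: measurable_funX. Qed.

Lemma measurable_signed_phase nu : measurable_fun setT (fun x : R => nu * `|x| * x).
Proof.
by apply: measurable_funM => //; exact: measurable_funM.
Qed.

Let measurable_hat A B al be (c : R -> R) : measurable_fun setT c ->
  measurable_fun setT (fun q => c q.2 * gauss_hat A B al be q).
Proof.
move=> mc; apply: measurable_funM; last exact: measurable_gauss_hat.
exact: (measurableT_comp mc measurable_snd).
Qed.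

Let normc_real (x : R) : 0 <= x -> Normc.normc (x%:C)%C = x.
Proof. by move=> x0; rewrite /= expr0n /= addr0 sqrtr_sqr ger0_norm. Qed.

Let normc_imag (x : R) : Normc.normc (0 +i* x)%C = `|x|.
Proof. by rewrite /= expr0n /= add0r sqrtr_sqr. Qed.

Let combine (X Y Z : \bar R) (C x y z : R) : 0 < C -> (0 <= Y)%E -> (0 <= Z)%E ->
  (x%:E <= X)%E -> (Y <= y%:E)%E -> (Z <= z%:E)%E -> (X <= C%:E * Y * Z)%E ->
  x <= C * y * z.
Proof.
move=> C0 Y0 Z0 xX Yy Zz XYZ; rewrite -lee_fin !EFinM.
apply: (le_trans xX); apply: (le_trans XYZ).
apply: lee_pmul => //; first by rewrite mule_ge0// lee_fin ltW.
by apply: lee_pmul => //; rewrite lee_fin ltW.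
Qed.

Let powR_sqr N a : 0 < N -> (N ^+ 2) `^ a = N `^ (2 * a).
Proof. by move=> N0; rewrite powRrM powR_mulrn ?ltW. Qed.

Let powRDp N a b : 0 < N -> N `^ (a + b) = N `^ a * N `^ b.
Proof. by move=> N0; rewrite powRD//; apply/implyP => _; rewrite gt_eqF. Qed.

Let sqrt_powR N r : 0 < N -> Num.sqrt (N `^ r) = N `^ (r / 2).
Proof. by move=> N0; rewrite -powR12_sqrt ?powR_ge0// -powRrM. Qed.

(* The scale L = N^r of the wave packets is N (r = 1), except when nu = 0,
   where packets of unit width (r = 0) stay close to the curve and lose less. *)
Lemma E2_fails nu s s' b b' c C r K : nu != 1 -> 0 <= r -> 0 <= K -> 0 < C ->
  s' + r / 2 < s + 2 * (c - 1) ->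
  (forall N d : R, 1 <= N -> `|nu * `|N + d| * (N + d) - nu * `|N| * N| <=
     K * (`|N `^ r * d| + (N `^ r * d) ^+ 2)) ->
  ~ E2 nu s s' b b' c C.
Proof.
move=> nu1 r0 K0 C0 lt_exp lipY hE2.
have kap0 : 0 < `|1 - nu| by rewrite normr_gt0 subr_eq0 eq_sym.
have [C1 C10 upX] := wnorm_wave_le s b (ler0n R 2).
have [C2 C20 upY] := wnorm_wave_le s' b' K0.
have [c0 c00 [N0 N01 low]] := wnorm_ge s (c - 1) kap0 (ler0n R 3).
apply: (@blowup c0 (C * (C1 * jap (0 : R) `^ s) * (C2 * 2 `^ `|s'|)) N0 _ _ c00 lt_exp).
move=> N NN0 N1; have Np : 0 < N by exact: lt_le_trans N1.
pose L := N `^ r.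
have L1 : 1 <= L by rewrite -(powRr0 N) ler_powR.
have L0 : 0 < L by exact: lt_le_trans L1.
have Li : 0 < L ^- 2 by rewrite invr_gt0 exprn_gt0.
(* This puts v on the curve of Y, so that the product lies at distance |1 - nu| N^2 from the curve
   of X. *)
pose al := - (nu * `|N| * N).
pose u := wave 1 (L ^- 2) 0 0; pose v := wave 1 (L ^- 2) al N.
have uvE : (fun p => (u p * v p)%R) = wave (1 + 1) (L ^- 2 + L ^- 2) al N.
  by apply/funext => p; rewrite waveM !add0r.
have h := hE2 u v (schwartz_wave _ _ ltr01 Li) (schwartz_wave _ _ ltr01 Li).
rewrite uvE in h.
have hu : (normX s b u <= (C1 * jap (0 : R) `^ s * Num.sqrt L)%:E)%E.
  apply: (upX _ _ _ _ measurable_sqr_phase) => //.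
    by rewrite expr0n oppr0.
  move=> d; apply: (le_trans (sqr_phase_lip _ _)).
  by apply: lip_scale => //; exact: ltW.
have hv : (normY nu s' b' v <= (C2 * jap N `^ s' * Num.sqrt L)%:E)%E.
  apply: (upY _ _ _ _ (measurable_signed_phase nu)) => //.
  by move=> d; exact: lipY.
have hw : ((c0 * 1 * N `^ s * (N ^+ 2) `^ (c - 1) * Num.sqrt L)%:E <=
    normX s (c - 1) (wave (1 + 1) (L ^- 2 + L ^- 2) al N))%E.
  have A2 : 0 < 1 + 1 :> R by rewrite addr_gt0.
  have B2 : 0 < L ^- 2 + L ^- 2 by rewrite addr_gt0.
  apply: (low (fun x => x ^+ 2) al N L 1 _
    (gauss_hat (1 + 1) (L ^- 2 + L ^- 2) al N)) => //.
  - exact: measurable_gauss_hat.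
  - by move=> q; rewrite fourier_wave// normc_real// gauss_hat_ge0.
  - rewrite /al (ger0_norm (ltW Np)) -[X in _ = _ * X](gtr0_norm (exprn_gt0 2 Np)) -normrM.
    by congr `|_|; ring.
  - by move=> d d01; apply: (le_trans (sqr_phase_lip _ _)); exact: lip_unit.
  - by move=> q _; rewrite mul1r.
have := combine C0 (Lnorm_ge0 _ _ _) (Lnorm_ge0 _ _ _) hw hu hv h.
(* One factor L^{1/2} cancels against the left-hand side; the other is N^{r/2} and enters the
   exponent of N on the right. *)
have sL : 0 < Num.sqrt L by rewrite sqrtr_gt0.
rewrite [leRHS](_ : _ = C * (C1 * jap (0 : R) `^ s) * (C2 * jap N `^ s') *
  Num.sqrt L * Num.sqrt L); last by ring.
rewrite ler_pM2r// mulr1 powR_sqr// -mulrA -powRDp// => /le_trans; apply.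
rewrite sqrt_powR// powRDp// [leRHS]mulrA ler_wpM2r ?powR_ge0//.
rewrite -[leRHS]mulrA -[_ * _ * N `^ s']mulrA ler_wpM2l//.
  by rewrite !mulr_ge0 ?powR_ge0 ?(ltW C0) ?(ltW C10).
by rewrite ler_wpM2l ?(ltW C20)// jap_powR_le.
Qed.

(** The summand 1 on the right of the exponent condition is the derivative, and 1/2 on the left is
    the factor L^{1/2} that remains for L = N. Since the packet at frequency N is one of X, it must
    be narrowed to width 1/N for every nu. *)
Lemma E1_fails nu s s' b c' C : nu != 1 -> 0 < C ->
  s + 1 / 2 < 1 + (s' + 2 * (c' - 1)) -> ~ E1 nu s s' b c' C.
Proof.
move=> nu1 C0 lt_exp hE1.
have kap0 : 0 < `|nu - 1| by rewrite normr_gt0 subr_eq0.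
have K0 : 0 <= 3 * `|nu| by rewrite mulr_ge0.
have [C1 C10 upX] := wnorm_wave_le s b (ler0n R 2).
have [c0 c00 [N0 N01 low]] := wnorm_ge s' (c' - 1) kap0 K0.
apply: (@blowup c0 (C * (C1 * 2 `^ `|s|) * (C1 * jap (0 : R) `^ s)) N0 _ _ c00 lt_exp).
move=> N NN0 N1; have Np : 0 < N by exact: lt_le_trans N1.
have Li : 0 < N ^- 2 by rewrite invr_gt0 exprn_gt0.
pose u1 := wave 1 (N ^- 2) (- N ^+ 2) N; pose u2 := wave 1 (N ^- 2) 0 0.
have uvE : (fun p => (u1 p * (u2 p)^*)%R) = wave (1 + 1) (N ^- 2 + N ^- 2) (- N ^+ 2) N.
  by apply/funext => p; rewrite -[(_^*)%R]/(_^*)%C conj_wave0 waveM !addr0.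
have h := hE1 u1 u2 (schwartz_wave _ _ ltr01 Li) (schwartz_wave _ _ ltr01 Li).
rewrite uvE in h.
have hu1 : (normX s b u1 <= (C1 * jap N `^ s * Num.sqrt N)%:E)%E.
  apply: (upX _ _ _ _ measurable_sqr_phase) => //.
  move=> d; apply: (le_trans (sqr_phase_lip _ _)).
  by apply: lip_scale => //; exact: ltW.
have hu2 : (normX s b u2 <= (C1 * jap (0 : R) `^ s * Num.sqrt N)%:E)%E.
  apply: (upX _ _ _ _ measurable_sqr_phase) => //.
    by rewrite expr0n oppr0.
  move=> d; apply: (le_trans (sqr_phase_lip _ _)).
  by apply: lip_scale => //; exact: ltW.
have hw : ((c0 * N * N `^ s' * (N ^+ 2) `^ (c' - 1) * Num.sqrt N)%:E <=
    normY nu s' (c' - 1) (dxC (wave (1 + 1) (N ^- 2 + N ^- 2) (- N ^+ 2) N)))%E.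
  have A2 : 0 < 1 + 1 :> R by rewrite addr_gt0.
  have B2 : 0 < N ^- 2 + N ^- 2 by rewrite addr_gt0.
  (* Here m = N: the multiplier |2 pi xi| is at least N for xi >= N. *)
  apply: (low (fun x => nu * `|x| * x) (- N ^+ 2) N N N _ (fun q =>
    (fun x => `|2 * pi * x|) q.2 * gauss_hat (1 + 1) (N ^- 2 + N ^- 2) (- N ^+ 2) N q)) => //.
  - exact: measurable_signed_phase.
  - apply: (@measurable_hat _ _ _ _ (fun x => `|2 * pi * x|)).
    by apply: measurableT_comp => //; exact: measurable_funM.
  - move=> q; rewrite fourier_dxC_wave// normc_imag normrM.
    by rewrite (ger0_norm (gauss_hat_ge0 _ _ _ _ _)).
  - exact: ltW.
  - rewrite (ger0_norm (ltW Np)) -[X in _ = _ * X](gtr0_norm (exprn_gt0 2 Np)) -normrM.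
    by congr `|_|; ring.
  - move=> d d01; apply: (le_trans (signed_phase_lip _ _ _)).
    by rewrite [leRHS]mulrAC [leRHS]mulrC ler_wpM2l// lip_unit.
  - move=> q qN; rewrite ler_wpM2r ?gauss_hat_ge0// ger0_norm; last first.
      by rewrite !mulr_ge0 ?pi_ge0// (le_trans (ltW Np)).
    rewrite (le_trans qN)// ler_peMl ?(le_trans (ltW Np))//.
    by have := pi_ge2 R; lra.
have := combine C0 (Lnorm_ge0 _ _ _) (Lnorm_ge0 _ _ _) hw hu1 hu2 h.
have sN : 0 < Num.sqrt N by rewrite sqrtr_gt0.
rewrite [leRHS](_ : _ = C * (C1 * jap N `^ s) * (C1 * jap (0 : R) `^ s) *
  Num.sqrt N * Num.sqrt N); last by ring.
rewrite ler_pM2r// powR_sqr// !powRDp// powRr1 ?(ltW Np)// !mulrA => /le_trans; apply.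
rewrite -powR12_sqrt ?(ltW Np)// div1r ler_wpM2r ?powR_ge0//.
rewrite [leRHS](_ : _ = C * (C1 * (2 `^ `|s| * N `^ s)) * C1 * jap (0 : R) `^ s); last by ring.
rewrite -!(mulrA C) ler_wpM2l ?(ltW C0)// !ler_wpM2r ?powR_ge0 ?(ltW C10)//.
by rewrite ler_wpM2l ?(ltW C10)// jap_powR_le.
Qed.

End Counterexamples.

Theorem theorem4p2 (R : realType) (nu s s' b b' c c' : R)
    (hnu : `|nu| <> 1) (hc : 1 / 2 < c) (hc' : 1 / 2 < c') :
  (s + 1 / 2 <= s' ->
     ~ exists C : R, 0 < C /\ E1 nu s s' b c' C) /\
  (s' <= s - 3 / 2 ->
     ~ exists C : R, 0 < C /\ E2 nu s s' b b' c C) /\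
  (nu = 0 -> s' <= s - 1 ->
     ~ exists C : R, 0 < C /\ E2 nu s s' b b' c C).
Proof.
have nu1 : nu != 1 by apply/eqP => nu1; apply: hnu; rewrite nu1 normr1.
split; [|split].
(* From c' > 1/2 one has 2(c' - 1) > -1, hence s + 1/2 <= s' < 1 + s' + 2(c' - 1). *)
- by move=> hs [C [C0]]; apply: E1_fails => //; lra.
(* With r = 1: s' + 1/2 <= s - 1 < s + 2(c - 1). *)
- move=> hs [C [C0]]; apply: (@E2_fails _ _ _ _ _ _ _ _ 1 (2 * `|nu|)) => //; first lra.
  move=> N d N1; rewrite powRr1 ?(le_trans _ N1)//.
  apply: (le_trans (signed_phase_lip _ _ _)).
  by rewrite [leRHS]mulrAC [leRHS]mulrC ler_wpM2l// lip_scale// (le_trans _ N1).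
(* The curve of Y is flat, so K = 0 and r = 0 are allowed, and s' <= s - 1 < s + 2(c - 1). *)
- move=> nu0 hs [C [C0]]; apply: (@E2_fails _ _ _ _ _ _ _ _ 0 0) => //; first lra.
  by move=> N d N1; rewrite nu0 !mul0r subrr normr0.
Qed.
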